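(* Let $G$ be a monster model, $A\subset G$ small, and let $H$ be an $A$-invariant subgroup of $G$ of bounded index (hence $G^{\infty}_A\subseteq H$). Let $i\colon G\to G/G^{\infty}_A$ be the quotient map, where $G/G^{\infty}_A$ carries the logic topology, and let $\mathrm{cl}$ denote closure in that topology. (i) $i^{-1}[\mathrm{cl}(i[H])]$ is the smallest type-definable subgroup of $G$ containing $H$; in fact $i^{-1}[\mathrm{cl}(i[H])]$ is type-definable over any small model containing $A$. (ii) If additionally $H\lhd G$ is normal, then \[ i^{-1}[\mathrm{cl}(i[H])]=\mathrm{cl}_A(H)\cdot X_{\Theta_A} \] and this is a normal subgroup of $G$. In particular $G^{00}_A=\mathrm{cl}_A(G^{\infty}_A)\cdot X_{\Theta_A}$.
   Context: $(G,\cdot,\ldots)$ is a group with additional first-order structure in a language $L$, assumed to be a monster model: $\overline{\kappa}$-saturated and $\overline{\kappa}$-strongly homogeneous for a large cardinal $\overline{\kappa}$; ''small'' and ''bounded'' mean cardinality $<\overline{\kappa}$. A set is $A$-invariant if fixed setwise by all automorphisms fixing $A$ pointwise; type-definable ($\bigwedge$-definable) over $B$ means an intersection of $B$-definable sets, with $B$ small. $G^{\infty}_A$ is the intersection of all $A$-invariant subgroups of $G$ of bounded index; $G^{00}_A$ is the intersection of all subgroups type-definable over $A$ of bounded index. The logic topology on $G/G^{\infty}_A$: fix a small elementary submodel $G'\prec G$ containing $A$; a set $X\subseteq G/G^{\infty}_A$ is closed iff $i^{-1}[X]$ is type-definable over $G'$. For $Y\subseteq G$, $\mathrm{cl}_A(Y)$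 is the closure of $Y$ in the topology on $G$ whose closed sets are the sets type-definable over $A$ (equivalently, the intersection of all $A$-definable sets containing $Y$). A symmetric formula $\varphi(x,y)$ over $A$ is thick if there is $n\in\mathbb N$ such that for every sequence $a_0,\ldots,a_{n-1}\in G$ (not necessarily distinct) there are $i<j<n$ with $\models\varphi(a_i,a_j)$; $\Theta_A(x,y)$ is the conjunction of all thick formulas over $A$, and $X_{\Theta_A}=\{a^{-1}b : a,b\in G,\ \Theta_A(a,b)\}$. *)

(* Defs.v *)
From HB Require Import structures.
From mathcomp Require Import all_boot.
From mathcomp Require Import boolp classical_sets functions cardinality.
From mathcomp Require Import topology.

Set Implicit Arguments.
Unset Strict Implicit.
Unset Printing Implicit Defensive.

Local Open Scope classical_set_scope.
Local Open Scope card_scope.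

Record language := Language {
  func : Type;
  farity : func -> nat;
  rel_sym : Type;
  rarity : rel_sym -> nat
}.

(* [V] is the type of free variables; a quantifier binds the variable [None]
   of [option V].  An [L]-formula with parameters in a set [B] and free
   variables in [W] is a [formula L (W + B)]. *)
Inductive term (L : language) (V : Type) : Type :=
| Var (x : V)
| App (f : func L) (t : 'I_(farity f) -> term L V).

Inductive formula (L : language) (V : Type) : Type :=
| Bot
| Eq (t u : term L V)
| Rel (r : rel_sym L) (t : 'I_(rarity r) -> term L V)
| Imp (p q : formula L V)
| All (p : formula L (option V)).

Arguments Var {L V} x.
Arguments App {L V} f t.
Arguments Bot {L V}.
Arguments Eq {L V} t u.
Arguments Rel {L V} r t.
Arguments Imp {L V} p q.
Arguments All {L V} p.

Record structure (L : language) (M : Type) := Structure {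
  fint : forall f : func L, ('I_(farity f) -> M) -> M;
  rint : forall r : rel_sym L, ('I_(rarity r) -> M) -> Prop
}.

Fixpoint teval L M (S : structure L M) V (v : V -> M) (t : term L V) : M :=
  match t with
  | Var x => v x
  | App f u => fint S (fun i => teval S v (u i))
  end.

Definition env_cons M V (v : V -> M) (a : M) (x : option V) : M :=
  if x is Some y then v y else a.

Fixpoint sat L M (S : structure L M) V (v : V -> M) (p : formula L V) : Prop :=
  match p with
  | Bot => False
  | Eq t u => teval S v t = teval S v u
  | Rel r t => rint S (fun i => teval S v (t i))
  | Imp p q => sat S v p -> sat S v q
  | All p => forall a : M, sat S (env_cons v a) p
  end.

Definition env_par M (B : set M) W (w : W -> M) (x : W + B) : M :=
  match x with inl y => w y | inr b => val b end.

Definition sat1 L M (S : structure L M) (B : set M)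
    (p : formula L (unit + B)) (a : M) : Prop :=
  sat S (env_par (fun _ : unit => a)) p.

Definition sat2 L M (S : structure L M) (B : set M)
    (p : formula L (bool + B)) (a b : M) : Prop :=
  sat S (env_par (fun i : bool => if i then b else a)) p.

Definition automorphism L M (S : structure L M) (s : M -> M) : Prop :=
  [/\ bijective s,
      forall (f : func L) (a : 'I_(farity f) -> M),
        s (fint S a) = fint S (s \o a)
    & forall (r : rel_sym L) (a : 'I_(rarity r) -> M),
        rint S (s \o a) <-> rint S a].

Definition automorphism_over L M (S : structure L M) (A : set M) (s : M -> M) :=
  automorphism S s /\ forall a, A a -> s a = a.

Definition aut_invariant L M (S : structure L M) (A X : set M) : Prop :=
  forall s, automorphism_over S A s -> s @` X = X.

(* [N] is an elementary substructure: it carries a structure for which the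
   inclusion preserves the truth of all sentences with parameters in [N]. *)
Definition elementary_submodel L M (S : structure L M) (N : set M) : Prop :=
  exists SN : structure L N,
    forall p : formula L N, sat SN id p <-> sat S val p.

Definition definable L M (S : structure L M) (B X : set M) : Prop :=
  exists p : formula L (unit + B), X = [set a | sat1 S p a].

Definition type_definable_over L M (S : structure L M) (B X : set M) : Prop :=
  exists2 D : set (set M), D `<=` definable S B & X = \bigcap_(Y in D) Y.

Definition tclosure L M (S : structure L M) (A Y : set M) : set M :=
  \bigcap_(D in [set D | definable S A D /\ Y `<=` D]) D.

(* The cardinal kappa-bar is the cardinality of a type [K]; [small K X] says
   |X| < |K|. *)

Definition small (K T : Type) (X : set T) : Prop :=
  (X #<= [set: K]) && ~~ ([set: K] #<= X).

Definition strong_limit (K : Type) : Prop :=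
  small K [set: nat] /\
  forall X : set K, small K X -> small K [set Y : set K | Y `<=` X].

Definition type_definable K L M (S : structure L M) (X : set M) : Prop :=
  exists2 B : set M, small K B & type_definable_over S B X.

Definition saturated K L M (S : structure L M) : Prop :=
  forall (B : set M) (p : set (formula L (unit + B))),
    small K B ->
    (forall q : set (formula L (unit + B)), finite_set q -> q `<=` p ->
       exists a, forall f, q f -> sat1 S f a) ->
    exists a, forall f, p f -> sat1 S f a.

(* A formula in [formula L B] is a sentence with parameters in [B], so [f] is
   a partial elementary map with domain [B]. *)
Definition strongly_homogeneous K L M (S : structure L M) : Prop :=
  forall (B : set M) (f : B -> M),
    small K B ->
    (forall p : formula L B, sat S val p <-> sat S f p) ->
    exists2 s, automorphism S s & forall b : B, s (val b) = f b.

(* A large kappa-bar is an uncountable strong limit cardinal above |L|; below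
   that, G^inf_A itself could fail to be normal or of bounded index. *)
Definition monster_model K L M (S : structure L M) : Prop :=
  [/\ strong_limit K, small K [set: func L + rel_sym L],
      saturated K S & strongly_homogeneous K S].

Definition is_subgroup (G : groupType) (H : set G) : Prop :=
  [/\ H 1%g, forall x y, H x -> H y -> H (x * y)%g
    & forall x, H x -> H (x^-1)%g].

Definition is_normal (G : groupType) (H : set G) : Prop :=
  is_subgroup H /\ forall g h, H h -> H (g * h * g^-1)%g.

Definition left_coset (G : groupType) (N : set G) (g : G) : set G :=
  [set (g * h)%g | h in N].

Definition left_cosets (G : groupType) (N : set G) : set (set G) :=
  range (left_coset N).

Definition bounded_index K (G : groupType) (H : set G) : Prop :=
  small K (left_cosets H).

Definition set_mul (G : groupType) (X Y : set G) : set G :=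
  [set (x * y)%g | x in X & y in Y].

Record group_language := GroupLanguage {
  group_lang :> language;
  mul_sym : func group_lang;
  mul_arity : farity mul_sym = 2
}.

(* [mul_sym L] is interpreted by the group law. *)
Definition expands_group (L : group_language) (G : groupType)
    (S : structure L G) : Prop :=
  forall a : 'I_(farity (mul_sym L)) -> G,
    fint S a = (a (cast_ord (esym (mul_arity L)) (@Ordinal 2 0 isT)) *
                a (cast_ord (esym (mul_arity L)) (@Ordinal 2 1 isT)))%g.

Section Components.
Variables (K : Type) (L : language) (G : groupType) (S : structure L G).
Variable A : set G.

Definition Ginf : set G :=
  \bigcap_(H in [set H | [/\ is_subgroup H, aut_invariant S A H
                           & bounded_index K H]]) H.

Definition G00 : set G :=
  \bigcap_(H in [set H | [/\ is_subgroup H, type_definable_over S A H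
                           & bounded_index K H]]) H.

Definition thick (p : formula L (bool + A)) : Prop :=
  (forall a b, sat2 S p a b <-> sat2 S p b a) /\
  exists n, forall a : 'I_n -> G,
    exists i j : 'I_n, i < j /\ sat2 S p (a i) (a j).

Definition Theta (a b : G) : Prop := forall p, thick p -> sat2 S p a b.

Definition XTheta : set G :=
  [set x | exists a b, Theta a b /\ x = (a^-1 * b)%g].

End Components.

(* G / G^inf_A is the type of left cosets of G^inf_A; [N] is the small model
   with respect to which its logic topology is defined. *)
Definition quot (K : Type) (L : language) (G : groupType) (S : structure L G)
    (A N : set G) : Type := left_cosets (Ginf K S A).

Definition quot_proj K L (G : groupType) (S : structure L G) (A N : set G)
    (g : G) : quot K S A N :=
  SigSub (mem_set (imageT (left_coset (Ginf K S A)) g)).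

Section LogicTopology.
Variables (K : Type) (L : language) (G : groupType) (S : structure L G).
Variables A N : set G.

Local Notation Q := (quot K S A N).
Local Notation pi := (@quot_proj K L G S A N).

HB.instance Definition _ := gen_eqMixin Q.
HB.instance Definition _ := gen_choiceMixin Q.

Definition logic_open : set_system Q :=
  [set U | type_definable_over S N (pi @^-1` (~` U))].

Lemma type_definable_overP (X : set G) :
  (forall a, ~ X a -> exists D, [/\ definable S N D, X `<=` D & ~ D a]) ->
  type_definable_over S N X.
Proof.
move=> h; exists [set D | definable S N D /\ X `<=` D]; first by move=> D [].
apply/seteqP; split=> [x Xx D [_]|x hx]; first exact.
by apply: contrapT => /h[D [dD XD]]; apply; apply: hx.
Qed.

Lemma logic_openT : logic_open setT.
Proof.
apply: type_definable_overP => a _; exists set0; split=> //.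
- by exists Bot; apply/seteqP; split.
- by move=> x; apply.
Qed.

Lemma logic_openI : setI_closed logic_open.
Proof.
move=> U V [D dD UD] [E dE VE].
apply: type_definable_overP => a /= /contrapT[Ua Va].
have [D1 DD1 nD1] : exists2 D1, D D1 & ~ D1 a.
  apply: contrapT => h; have : (pi @^-1` (~` U)) a; last exact.
  by rewrite UD => D1 DD1; apply: contrapT => na; apply: h; exists D1.
have [E1 EE1 nE1] : exists2 E1, E E1 & ~ E1 a.
  apply: contrapT => h; have : (pi @^-1` (~` V)) a; last exact.
  by rewrite VE => E1 EE1; apply: contrapT => na; apply: h; exists E1.
exists (D1 `|` E1); split; last by case.
- have [p ->] := dD _ DD1; have [q ->] := dE _ EE1.
  exists (Imp (Imp p Bot) q); apply/seteqP; split=> x /=; rewrite /sat1 /=.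
  + by case.
  + by move=> h; case: (pselect (sat1 S p x)) => ?; [left|right; apply: h].
- move=> x /= /not_andP[nU|nV].
  + left; have : (pi @^-1` (~` U)) x by [].
    by rewrite UD; apply.
  + right; have : (pi @^-1` (~` V)) x by [].
    by rewrite VE; apply.
Qed.

Lemma logic_open_bigU (I : Type) (f : I -> set Q) :
  (forall i, logic_open (f i)) -> logic_open (\bigcup_i f i).
Proof.
move=> fo; apply: type_definable_overP => a /= /contrapT[i _ fia].
have [D dD fD] := fo i.
have [D1 DD1 nD1] : exists2 D1, D D1 & ~ D1 a.
  apply: contrapT => h; have : (pi @^-1` (~` f i)) a; last exact.
  by rewrite fD => D1 DD1; apply: contrapT => na; apply: h; exists D1.
exists D1; split=> //; first exact: dD.
move=> x /= nx; have : (pi @^-1` (~` f i)) x by move=> fx; apply: nx; exists i.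
by rewrite fD; apply.
Qed.

HB.instance Definition _ :=
  isOpenTopological.Build Q logic_openT logic_openI logic_open_bigU.

Lemma logic_closedE (X : set Q) :
  closed X <-> type_definable_over S N (pi @^-1` X).
Proof. by rewrite -openC /open /= /logic_open /= setCK. Qed.

End LogicTopology.

Arguments quot_proj K {L G} S A N g.

(* Main.v *)
(* Write [X_R] for the set of all [a^-1 b] with [R a b], so that [X_Theta] is
   the intersection of the [X_R] over the thick [R].

   An [A]-invariant subgroup [H] of bounded index contains [X_Theta]: a pair
   with [Theta a b] starts long [tp(a, b / A)]-chains, and by the pigeonhole
   principle and compactness some realization of [tp(a, b / A)] lies in one
   coset of [H].  Hence elements with the same type over a model, or over any
   set containing a finite cover of [G] for every thick relation over [A], are
   congruent modulo [G^inf], and a type-definable union of cosets of [G^inf] is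
   type-definable over each such set.  So the closure of [H] is the least
   type-definable union of [G^inf]-cosets containing [H]; as [G^inf] is normal,
   translating it shows that it is a subgroup.

   For normal [H] the point is that [H X_R] is a neighbourhood of [1] in the
   logic topology: for every thick [R] there is a thick [R'], with finitely many
   more parameters, such that [X_R' X_R'] is contained in [H X_R].  Hence the
   closure of [H] is contained in [D X_R] for all thick [R] and all
   [A]-definable [D] containing [H]; then compactness yields
   [cl_A(H) X_Theta]. *)

Require Import Defs.
From mathcomp Require Import all_boot.
From mathcomp Require Import boolp classical_sets functions cardinality.
From mathcomp Require Import topology.

Set Implicit Arguments.
Unset Strict Implicit.
Unset Printing Implicit Defensive.

Local Open Scope classical_set_scope.

(** * Renaming of variables and definable predicates *)

Fixpoint trename L V W (f : V -> W) (t : term L V) : term L W :=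
  match t with
  | Var x => Var (f x)
  | App g u => App g (fun i => trename f (u i))
  end.

Fixpoint frename L V W (f : V -> W) (p : formula L V) : formula L W :=
  match p with
  | Bot => Bot
  | Eq t u => Eq (trename f t) (trename f u)
  | Rel r t => Rel r (fun i => trename f (t i))
  | Imp p q => Imp (frename f p) (frename f q)
  | All p => All (frename (omap f) p)
  end.

Section Semantics.
Variables (L : language) (M : Type) (S : structure L M).

Lemma teval_rename V W (f : V -> W) (v : W -> M) (t : term L V) :
  teval S v (trename f t) = teval S (v \o f) t.
Proof. by elim: t => //= g u IH; congr fint; apply/funext => i; apply: IH. Qed.

Lemma sat_rename V W (f : V -> W) (v : W -> M) (p : formula L V) :
  sat S v (frename f p) <-> sat S (v \o f) p.
Proof.
elim: p W f v => {V}[V|V t u|V r t|V p IHp q IHq|V p IHp] W f v //=.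
- by rewrite !teval_rename.
- suff -> : (fun i => teval S v (trename f (t i))) =
            fun i => teval S (v \o f) (t i) by [].
  by apply/funext => i; rewrite teval_rename.
- by rewrite IHp IHq.
- suff E a : env_cons v a \o omap f = env_cons (v \o f) a.
    by split=> h a; have := h a; rewrite IHp E.
  by apply/funext; case.
Qed.

Lemma eq_sat V (v w : V -> M) (p : formula L V) :
  v =1 w -> sat S v p <-> sat S w p.
Proof. by move=> /funext ->. Qed.

Lemma sat_eq V (v w : V -> M) (p : formula L V) :
  v =1 w -> sat S v p -> sat S w p.
Proof. by move=> /(eq_sat p)[]. Qed.

Lemma teval_automorphism (s : M -> M) V (v : V -> M) (t : term L V) :
  automorphism S s -> teval S (s \o v) t = s (teval S v t).
Proof.
move=> [_ sf _]; elim: t => //= g u IH.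
by rewrite sf; congr fint; apply/funext => i; apply: IH.
Qed.

Lemma sat_automorphism (s : M -> M) V (v : V -> M) (p : formula L V) :
  automorphism S s -> sat S (s \o v) p <-> sat S v p.
Proof.
move=> hs; have [[s' sK s'K] _ sr] := hs.
elim: p v => {V}[V|V t u|V r t|V p IHp q IHq|V p IHp] v //=.
- by rewrite !teval_automorphism //; split=> [/(can_inj sK)|->].
- suff -> : (fun i => teval S (s \o v) (t i)) =
            s \o (fun i => teval S v (t i)) by exact: sr.
  by apply/funext => i /=; rewrite teval_automorphism.
- by rewrite IHp IHq.
- have E a : env_cons (s \o v) (s a) = s \o env_cons v a by apply/funext; case.
  split=> h a; first by apply/IHp; rewrite -E; apply: h.
  by rewrite -[a]s'K E; apply/IHp; apply: h.
Qed.

End Semantics.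

(* [dpred B v P]: the predicate [P] on the type [E] of environments is
   definable over [B] in the variables [V], whose values are given by [v]. *)
Definition dpred L M (S : structure L M) (B : set M) (E V : Type)
    (v : V -> E -> M) (P : E -> Prop) : Prop :=
  exists p : formula L (V + B), forall e, sat S (env_par (v^~ e)) p <-> P e.

Definition vcons M (E V : Type) (v : V -> E -> M) (x : option V) (e : E * M) :=
  if x is Some y then v y e.1 else e.2.

(** A function enters through its graph, so [t] need not be a term of the language; this admits the
    group inverse, for which no symbol is assumed. *)
Definition dterm L M (S : structure L M) (B : set M) (E V : Type)
    (v : V -> E -> M) (t : E -> M) : Prop :=
  dpred S B (vcons v) (fun e => e.2 = t e.1).

Definition var1 (M : Type) (_ : unit) (a : M) : M := a.
Definition var2 (M : Type) (i : bool) (a : M * M) : M := if i then a.2 else a.1.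

Definition definable2 L M (S : structure L M) (B : set M)
    (R : M -> M -> Prop) : Prop :=
  dpred S B (@var2 M) (fun a => R a.1 a.2).

Section Definability.
Variables (L : language) (M : Type) (S : structure L M).
Implicit Types B : set M.

Lemma dpred_ext B E V (v : V -> E -> M) P Q :
  (forall e, P e <-> Q e) -> dpred S B v P -> dpred S B v Q.
Proof. by move=> PQ [p hp]; exists p => e; rewrite hp. Qed.

(** Changes of variables and of parameter sets reduce to this one: each old variable is read as a
    new variable or as a parameter, and [h] is the matching map of environments. *)
Lemma dpred_reindex B B' E E' V V' (v : V -> E -> M) (v' : V' -> E' -> M)
    (h : E' -> E) P :
  (forall x, (exists y, forall e, v' y e = v x (h e)) \/
             (exists2 b, B' b & forall e, b = v x (h e))) ->
  B `<=` B' -> dpred S B v P -> dpred S B' v' (P \o h).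
Proof.
move=> hv BB' [p hp].
have /choice[f hf] (x : V) : exists y : V' + B', forall e,
    env_par (v'^~ e) y = v x (h e).
  case: (hv x) => [[y hy]|[b Bb hb]]; first by exists (inl y).
  by exists (inr (SigSub (mem_set Bb))).
have gP (b : B) : B' (val b) by apply/BB'/set_mem/valP.
exists (frename (fun x => match x with inl x => f x
                          | inr b => inr (SigSub (mem_set (gP b))) end) p) => e.
rewrite sat_rename /= -hp.
by apply: eq_sat => -[x|//] /=; rewrite hf.
Qed.

Lemma dpred_sub B B' E V (v : V -> E -> M) P :
  B `<=` B' -> dpred S B v P -> dpred S B' v P.
Proof.
move=> BB'; apply: (@dpred_reindex B B' E E V V v v id) => // x.
by left; exists x.
Qed.

Section Connectives.
Variables (B : set M) (E V : Type) (v : V -> E -> M).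
Local Notation D := (dpred S B v).

Lemma dpred_False : D (fun _ => False).
Proof. by exists Bot. Qed.

Lemma dpred_imp P Q : D P -> D Q -> D (fun e => P e -> Q e).
Proof. by move=> [p hp] [q hq]; exists (Imp p q) => e /=; rewrite hp hq. Qed.

Lemma dpred_not P : D P -> D (fun e => ~ P e).
Proof. by move=> hP; apply: dpred_imp => //; apply: dpred_False. Qed.

Lemma dpred_True : D (fun _ => True).
Proof. by apply: (dpred_ext _ (dpred_not dpred_False)); tauto. Qed.

Lemma dpred_and P Q : D P -> D Q -> D (fun e => P e /\ Q e).
Proof.
move=> hP hQ; apply: (dpred_ext _ (dpred_not (dpred_imp hP (dpred_not hQ)))).
by move=> e; split=> [/not_implyP[? /contrapT]|[? ?]]; [split|apply].
Qed.

Lemma dpred_or P Q : D P -> D Q -> D (fun e => P e \/ Q e).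
Proof.
move=> hP hQ; apply: (dpred_ext _ (dpred_imp (dpred_not hP) hQ)).
move=> e; split=> [h|[?|?]] //; case: (pselect (P e)) => ?; [left|right] => //.
exact: h.
Qed.

End Connectives.

Section Quantifiers.
Variables (B : set M) (E V : Type) (v : V -> E -> M).
Local Notation D := (dpred S B v).

Lemma dpred_all (P : E -> M -> Prop) :
  dpred S B (vcons v) (fun e => P e.1 e.2) -> D (fun e => forall a, P e a).
Proof.
move=> [p hp].
(* The quantifier binds the outermost [None], so variables in [option V + B] are renamed into
   [option (V + B)]. *)
exists (All (frename (fun x => match x with
   | inl (Some y) => Some (inl y) | inl None => None
   | inr b => Some (inr b) end) p)) => e /=.
suff h a : sat S (env_cons (env_par (v^~ e)) a) (frename (fun x => match x with
    | inl (Some y) => Some (inl y) | inl None => None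
    | inr b => Some (inr b) end) p) <-> P e a.
  by split=> H a; apply/h.
by rewrite sat_rename -(hp (e, a)); apply: eq_sat => -[[]|].
Qed.

Lemma dpred_ex (P : E -> M -> Prop) :
  dpred S B (vcons v) (fun e => P e.1 e.2) -> D (fun e => exists a, P e a).
Proof.
move=> hP.
have hn : D (fun e => ~ forall a, ~ P e a).
  by apply/dpred_not/dpred_all/dpred_not.
apply: (dpred_ext _ hn) => e; split=> [/existsNP[a /contrapT]|[a Pa] /(_ a)//].
by exists a.
Qed.

Lemma dterm_var x t : (forall e, v x e = t e) -> dterm S B v t.
Proof.
move=> h; exists (Eq (Var (inl None)) (Var (inl (Some x)))) => -[e a] /=.
by rewrite h.
Qed.

Lemma dterm_par b : B b -> dterm S B v (fun _ => b).
Proof.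
by move=> Bb; exists (Eq (Var (inl None)) (Var (inr (SigSub (mem_set Bb))))).
Qed.

Lemma dterm_weaken t :
  dterm S B v t -> dterm S B (vcons v) (fun e => t e.1).
Proof.
apply: (@dpred_reindex B B _ _ _ _ (vcons v) (vcons (vcons v))
  (fun e => (e.1.1, e.2))) => // -[x|]; left; first by exists (Some (Some x)).
by exists None.
Qed.

Lemma dpred_subst (P : E -> M -> Prop) t : dterm S B v t ->
  dpred S B (vcons v) (fun e => P e.1 e.2) -> D (fun e => P e (t e)).
Proof.
move=> ht hP.
apply: (@dpred_ext _ _ _ _ (fun e => exists a, a = t e /\ P e a)).
  by move=> e; split=> [[a [->]]|?] //; exists (t e).
by apply: dpred_ex; apply: dpred_and.
Qed.

End Quantifiers.

Section Atoms.
Variables (B : set M) (E V : Type) (v : V -> E -> M).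
Local Notation D := (dpred S B v).

Lemma dpred_definable D1 t : definable S B D1 -> dterm S B v t ->
  D (fun e => D1 (t e)).
Proof.
move=> [p ->] ht; apply: (dpred_subst (P := fun _ a => sat1 S p a)) => //.
apply: (@dpred_reindex B B M _ unit _ (@var1 M) (vcons v) snd).
- by case; left; exists None.
- by [].
- by exists p.
Qed.

Lemma dpred_eq t u : dterm S B v t -> dterm S B v u -> D (fun e => t e = u e).
Proof. by move=> ht hu; apply: (dpred_subst (P := fun e a => a = u e)). Qed.

End Atoms.

Lemma dpred_rel B E V (v : V -> E -> M) R t u : definable2 S B R ->
  dterm S B v t -> dterm S B v u -> dpred S B v (fun e => R (t e) (u e)).
Proof.
move=> hR ht hu; apply: (dpred_subst (P := fun e a => R a (u e))) => //.
apply: (dpred_subst (P := fun e a => R e.2 a)).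
  by apply: dterm_weaken.
apply: (@dpred_reindex B B _ _ _ _ (@var2 M) (vcons (vcons v))
  (fun e => (e.1.2, e.2)) (fun a => R a.1 a.2)) => // -[]; left.
  by exists None.
by exists (Some None).
Qed.

Lemma definableE B D : dpred S B (@var1 M) D <-> definable S B D.
Proof.
split=> [[p hp]|[p ->]]; last by exists p.
by exists p; apply/seteqP; split=> a /hp.
Qed.

Lemma definable2P B R :
  definable2 S B R <->
  exists p : formula L (bool + B), forall a b, sat2 S p a b <-> R a b.
Proof.
split; last by case=> p hp; exists p => -[a b]; apply: hp.
by case=> p hp; exists p => a b; apply: (hp (a, b)).
Qed.

Lemma definable_sub B B' D : B `<=` B' -> definable S B D -> definable S B' D.
Proof. by move=> BB' /definableE/(dpred_sub BB')/definableE. Qed.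

Lemma definable2_sub B B' R :
  B `<=` B' -> definable2 S B R -> definable2 S B' R.
Proof. exact: dpred_sub. Qed.

End Definability.

(** The goal shows only a function on environments, not the variable behind it. The variables that
    arise from one or two free variables under a few quantifiers are tried in turn, up to
    conversion. *)
Ltac dvar :=
  let try_var x := exact (dterm_var (x := x) _ _ (fun=> erefl)) in
  first [ try_var (@None unit) | try_var (@None (option unit))
        | try_var (@None (option (option unit)))
        | try_var tt | try_var (Some tt) | try_var (Some (Some tt))
        | try_var (Some (Some (Some tt)))
        | try_var (Some (@None unit)) | try_var (Some (@None (option unit)))
        | try_var (Some (Some (@None unit)))
        | try_var true | try_var false
        | try_var (Some true) | try_var (Some false) | try_var (@None bool) ].

(** * Small sets *)

Lemma card_le_inj T U (X : set T) (Y : set U) (f : T -> U) :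
  set_fun X Y f -> {in X &, injective f} -> (X #<= Y)%card.
Proof.
by move=> fXY fI; have [g] := injfunPex.2 (ex_intro2 _ _ f fXY fI);
   apply: inj_card_le.
Qed.

Lemma card_leT_inj K T (X : set T) (k : K) :
  (X #<= [set: K])%card -> exists f : T -> K, {in X &, injective f}.
Proof.
elim/Ppointed: K => K in k *; first by case: (no k).
by move=> /pcard_injP.
Qed.

(** Zorn's lemma on graphs of partial bijections: a maximal one is total on one side, since
    otherwise a pair of uncovered points could be adjoined. *)
Lemma card_leT_total T U :
  (exists f : T -> U, injective f) \/ (exists f : U -> T, injective f).
Proof.
pose P := [set C : set (T * U) |
  forall p q, C p -> C q -> p.1 = q.1 <-> p.2 = q.2].
have [F FP totF|C [PC maxC]] := Zorn_bigcup (P := P).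
  move=> p q [X FX Xp] [Y FY Yq].
  have [XY|YX] := totF _ _ FX FY; first by apply: (FP _ FY) => //; apply: XY.
  by apply: (FP _ FX) => //; apply: YX.
have [hT|/existsNP[t nt]] := pselect (forall t, exists u, C (t, u)).
  left; have [f hf] := choice hT; exists f => x y fxy.
  by have [_] := PC _ _ (hf x) (hf y); apply.
have [hU|/existsNP[u nu]] := pselect (forall u, exists t, C (t, u)).
  right; have [f hf] := choice hU; exists f => x y fxy.
  by have [+ _] := PC _ _ (hf x) (hf y); apply.
exfalso; apply: (maxC (C `|` [set (t, u)])).
  split; first by move=> x; left.
  by move=> /(_ (t, u)) Ctu; apply: nt; exists u; apply: Ctu; right.
have new x y : C (x, y) -> x = t <-> y = u.
  move=> Cxy; split=> E; first by case: nt; exists y; rewrite -E.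
  by case: nu; exists x; rewrite -E.
move=> [x y] [x' y'] [Cp|[-> ->]] [Cq|[-> ->]] //=; first exact: PC Cp Cq.
- exact: new.
- by have [h h'] := new _ _ Cq; split=> /esym => [/h|/h'].
Qed.

Section Small.
Variable K : Type.

Lemma small_le T U (X : set T) (Y : set U) :
  (X #<= Y)%card -> small K Y -> small K X.
Proof.
move=> XY /andP[YK nKY]; rewrite /small (card_le_trans XY YK) /=.
by apply: contra nKY => /card_le_trans; apply.
Qed.

Lemma small_inj T U (X : set T) (Y : set U) (f : T -> U) :
  set_fun X Y f -> {in X &, injective f} -> small K Y -> small K X.
Proof. by move=> fXY fI; apply/small_le/(card_le_inj fXY fI). Qed.

Lemma small_sub T (X Y : set T) : X `<=` Y -> small K Y -> small K X.
Proof. by move=> /subset_card_le; apply: small_le. Qed.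

Lemma small_image T U (f : T -> U) X : small K X -> small K (f @` X).
Proof. by apply/small_le/card_image_le. Qed.

Lemma small_set_type T (X : set T) : small K X -> small K [set: X].
Proof.
by apply: small_le; have := card_setT X; rewrite card_eq_le => /andP[].
Qed.

Hypothesis hK : strong_limit K.

Lemma small_nat : small K [set: nat]. Proof. by case: hK. Qed.

(** [strong_limit] speaks only of subsets of [K]; an injection of [X] into [K] carries the bound
    over. *)
Lemma small_powerset T (X : set T) : small K X -> small K [set Y | Y `<=` X].
Proof.
(* An empty [K] would embed in [nat], although [nat] is small. *)
have Kn : exists k : K, True.
  have [sn _] := hK; apply: contrapT => nK; have /andP[_ /negP] := sn; apply.
  by apply: (@card_le_inj _ _ _ _ (fun=> 0)) => // k; case: nK; exists k.
have [k _] := Kn; move=> sX; have /andP[XK _] := sX.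
have [f fI] := card_leT_inj k XK.
apply: (@small_inj _ _ _ [set Z | Z `<=` f @` X] (image^~ f)).
- by move=> Y YX; apply: image_subset.
- move=> Y Z /set_mem YX /set_mem ZX YZ.
  have sub (U W : set T) : U `<=` X -> W `<=` X -> f @` U = f @` W -> U `<=` W.
    move=> UX WX UW x Ux; have : (f @` W) (f x) by rewrite -UW; exists x.
    by move=> [y Wy /fI <-] //; apply/mem_set; [apply: WX|apply: UX].
  by apply/seteqP; split; apply: sub.
- by have [_] := hK; apply; apply: small_image.
Qed.

Lemma small_set (T : Type) : small K [set: T] -> small K [set: set T].
Proof. by move=> /small_powerset; apply: small_sub. Qed.

(** Closure under powersets replaces cardinal arithmetic: [(t, b)] is coded in the double powerset
    as [{{t}}] or as [{{t}, empty}]. *)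
Lemma small_double (T : Type) : small K [set: T] -> small K [set: T * bool].
Proof.
move=> /small_set/small_set; pose f (x : T * bool) : set (set T) :=
  if x.2 then [set [set x.1]] else [set [set x.1]; set0].
have f1 x : f x [set x.1] by rewrite /f; case: x.2 => //=; left.
have n0 (t : T) : [set t] <> set0 by move=> E; suff : set0 t by []; rewrite -E.
have f0 x : f x set0 <-> x.2 = false.
  by rewrite /f; case: x.2; split=> //=; [move/esym/n0|right].
have f1P x t : f x [set t] -> t = x.1.
  suff E : [set t] = [set x.1] -> t = x.1.
    by rewrite /f; case: x.2 => //= -[|/n0].
  by move=> E; suff : [set x.1] t by []; rewrite -E.
apply: (@small_inj _ _ _ _ f) => // -[t b] [u c] _ _ E.
have /= -> : t = u by apply: (f1P (u, c)); rewrite -E; apply: (f1 (t, b)).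
congr pair; apply/idP/idP; apply: contraTT => /negbTE h; apply/negbT.
  by apply/(f0 (t, b)); rewrite E; apply/f0.
by apply/(f0 (u, c)); rewrite -E; apply/f0.
Qed.

Lemma small_sum (T U : Type) :
  small K [set: T] -> small K [set: U] -> small K [set: T + U].
Proof.
move=> sT sU; have [[f fI]|[f fI]] := card_leT_total T U.
  apply: (@small_inj _ _ _ _
    (fun x => match x with inl t => (f t, true) | inr u => (u, false) end)
    _ _ (small_double sU)) => //.
  by move=> [t|u] [t'|u'] _ _ //= [] => [/fI|] ->.
apply: (@small_inj _ _ _ _
  (fun x => match x with inl t => (t, true) | inr u => (f u, false) end)
  _ _ (small_double sT)) => //.
by move=> [t|u] [t'|u'] _ _ //= [] => [|/fI] ->.
Qed.

(** Kuratowski pairs, with the coordinates tagged by [inl] and [inr] so that they live in one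
    type. *)
Lemma small_prod (T U : Type) :
  small K [set: T] -> small K [set: U] -> small K [set: T * U].
Proof.
move=> sT sU; have /small_set/small_set := small_sum sT sU.
pose f (x : T * U) : set (set (T + U)) :=
  [set [set inl x.1]; [set inl x.1; inr x.2]].
apply: (@small_inj _ _ _ _ f) => // -[t u] [t' u'] _ _ E.
have : f (t', u') [set inl t; inr u] by rewrite -E; right.
move=> [/= E'|/= E'].
  have : ([set inl t; inr u] : set (T + U)) (inr u) by right.
  by rewrite E'.
have : ([set inl t; inr u] : set (T + U)) (inl t) by left.
have : ([set inl t; inr u] : set (T + U)) (inr u) by right.
by rewrite E' => -[|[->]] // [[->]|].
Qed.

Lemma small_fun (T U : Type) :
  small K [set: T] -> small K [set: U] -> small K [set: T -> U].
Proof.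
move=> sT sU; have /small_set := small_prod sT sU.
apply: (@small_inj _ _ _ _ (fun f => [set x | f x.1 = x.2])) => // f g _ _ E.
apply/funext => t; suff : [set x | g x.1 = x.2] (t, f t) by move=> /= ->.
by rewrite -E.
Qed.

Lemma small_setU T (X Y : set T) : small K X -> small K Y -> small K (X `|` Y).
Proof.
move=> /small_set_type sX /small_set_type sY.
have := small_image (fun z => match z with inl x => val x | inr y => val y end)
  (small_sum sX sY).
apply: small_sub => t [Xt|Yt].
  by exists (inl (SigSub (mem_set Xt))).
by exists (inr (SigSub (mem_set Yt))).
Qed.

Lemma small_countable (T : Type) (X : set T) : countable X -> small K X.
Proof. by move=> cX; apply: small_le small_nat. Qed.

End Small.

(* A formula is determined by its syntax tree, viewed as a function from
   positions to labels; a variable bound by the [n]-th enclosing quantifier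
   is labelled [inl n]. *)
Section Codes.
Variables (L : language) (W : Type).
Local Notation label := (nat + ((func L + rel_sym L) + (nat + W)))%type.

Fixpoint tcode V (e : V -> nat + W) (t : term L V) (s : seq nat) : label :=
  match t with
  | Var x => inr (inr (e x))
  | App f u =>
    if s is i :: s' then
      if insub i is Some j then tcode e (u j) s' else inl 0
    else inr (inl (inl f))
  end.

Definition code_cons V (e : V -> nat + W) (x : option V) : nat + W :=
  if x is Some y then
    match e y with inl n => inl n.+1 | inr w => inr w end
  else inl 0.

Fixpoint fcode V (e : V -> nat + W) (p : formula L V) (s : seq nat) : label :=
  match p with
  | Bot => inl 1
  | Eq t u =>
    match s with
    | [::] => inl 2 | 0 :: s' => tcode e t s' | _ :: s' => tcode e u s'
    end
  | Rel r t =>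
    if s is i :: s' then
      if insub i is Some j then tcode e (t j) s' else inl 0
    else inr (inl (inr r))
  | Imp p q =>
    match s with
    | [::] => inl 3 | 0 :: s' => fcode e p s' | _ :: s' => fcode e q s'
    end
  | All p => if s is _ :: s' then fcode (code_cons e) p s' else inl 4
  end.

Lemma tcode_inj V (e : V -> nat + W) : injective e -> injective (tcode e).
Proof.
move=> eI; elim=> [x|f u IH] [y|g w] E; have := congr1 (@^~ [::]) E => //=.
  by case=> /eI ->.
case=> fg; case: _ / fg in w E *; congr App; apply/funext => i; apply: IH.
by apply/funext => s; have := congr1 (@^~ (val i :: s)) E; rewrite /= valK.
Qed.

Lemma code_cons_inj V (e : V -> nat + W) :
  injective e -> injective (code_cons e).
Proof.
move=> eI [x|] [y|] //=.
- move=> E; congr Some; apply: eI; move: E.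
  by case: (e x) (e y) => [n|w] [m|w'] // [->].
- by case: (e x).
- by case: (e y).
Qed.

Lemma fcode_inj V (e : V -> nat + W) : injective e -> injective (fcode e).
Proof.
move=> eI p; elim: p e eI => {V}[V|V t u|V r t|V p IHp q IHq|V p IHp] e eI
  [|t' u'|r' t'|p' q'|p'] E; have E0 := congr1 (@^~ [::]) E => //=.
- congr Eq; apply: (tcode_inj eI); apply/funext => s.
    exact: (congr1 (@^~ (0 :: s)) E).
  exact: (congr1 (@^~ (1 :: s)) E).
- move: E0 => /= -[rr]; case: _ / rr in t' E *; congr Rel; apply/funext => i.
  apply: (tcode_inj eI); apply/funext => s.
  by have := congr1 (@^~ (val i :: s)) E; rewrite /= valK.
- congr Imp; [apply: (IHp _ eI)|apply: (IHq _ eI)]; apply/funext => s.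
    exact: (congr1 (@^~ (0 :: s)) E).
  exact: (congr1 (@^~ (1 :: s)) E).
- congr All; apply: (IHp _ (code_cons_inj eI)); apply/funext => s.
  exact: (congr1 (@^~ (0 :: s)) E).
Qed.

End Codes.

(** The codes are functions from a countable set of positions to a small set of labels; [inr] keeps
    the free variables apart from the bound ones. *)
Lemma small_formula K (hK : strong_limit K) L V :
  small K [set: func L + rel_sym L] -> small K [set: V] ->
  small K [set: formula L V].
Proof.
move=> sL sV; have sN := small_nat hK.
have := small_fun hK (small_countable hK (countableP [set: seq nat]))
  (small_sum hK sN (small_sum hK sL (small_sum hK sN sV))).
apply: (small_inj (f := fcode inr)) => // p q _ _.
by apply: fcode_inj => x y [].
Qed.

(** * Homogeneity and compactness *)

Definition directed M (I : Type) (P : set I) (F : I -> set M) : Prop :=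
  forall i j, P i -> P j -> exists2 k, P k & F k `<=` F i `&` F j.

(** Serves [compactness]: finitely many formulas, each implied by a member of a directed family, are
    all implied by a single member. *)
Lemma finite_directed (T I : Type) (P : set I) (R : I -> T -> Prop)
    (q : set T) :
  finite_set q -> (exists i, P i) ->
  (forall i j, P i -> P j ->
     exists2 k, P k & forall t, R i t \/ R j t -> R k t) ->
  (forall t, q t -> exists2 i, P i & R i t) ->
  exists2 i, P i & forall t, q t -> R i t.
Proof.
elim/Peq: T => T in R q *; move=> /finite_seqP[s ->] [i0 Pi0] dir.
elim: s => [|t s IH] qR; first by exists i0.
have [u us|i Pi iR] := IH; first by apply: qR; rewrite /= inE us orbT.
have [|j Pj jR] := qR t; first by rewrite /= inE eqxx.
have [k Pk kR] := dir i j Pi Pj; exists k => // u.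
by rewrite /= inE => /orP[/eqP->|/iR ?]; apply: kR; [right|left].
Qed.

Section Automorphisms.
Variables (L : language) (M : Type) (S : structure L M).

Lemma automorphism_over_inv (A : set M) s : automorphism_over S A s ->
  exists2 s', automorphism_over S A s' & cancel s s' /\ cancel s' s.
Proof.
move=> [[[s' sK s'K] sf sr] sA]; exists s' => //; split; last first.
  by move=> a Aa; rewrite -{1}(sA a Aa).
split; first by exists s.
  move=> f a; apply: (can_inj sK); rewrite s'K sf; congr fint.
  by apply/funext => i; rewrite /comp s'K.
move=> r a; rewrite -sr.
by have -> : s \o (s' \o a) = a by apply/funext => i; rewrite /comp s'K.
Qed.

Lemma automorphism_over_sub (A B : set M) s : A `<=` B ->
  automorphism_over S B s -> automorphism_over S A s.
Proof. by move=> AB [hs sB]; split=> // a /AB/sB. Qed.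

Lemma aut_invariantP (A X : set M) : aut_invariant S A X <->
  forall s, automorphism_over S A s -> forall x, X x -> X (s x).
Proof.
split=> [h s hs x Xx|h s hs]; first by rewrite -(h s hs); exists x.
have [s' hs' [sK s'K]] := automorphism_over_inv hs.
apply/seteqP; split=> [_ [x Xx <-]|x Xx]; first exact: h.
by exists (s' x); [apply: h|].
Qed.

Lemma aut_invariantE (A X : set M) s x :
  aut_invariant S A X -> automorphism_over S A s -> X (s x) <-> X x.
Proof.
move=> /aut_invariantP h hs; split; last exact: h.
have [s' hs' [sK _]] := automorphism_over_inv hs.
by move=> /(h _ hs'); rewrite sK.
Qed.

Lemma aut_invariant_sub (A B X : set M) : A `<=` B ->
  aut_invariant S A X -> aut_invariant S B X.
Proof. by move=> AB h s /(automorphism_over_sub AB)/h. Qed.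

Lemma definable_automorphism (B D : set M) s : definable S B D ->
  automorphism_over S B s -> forall x, D (s x) <-> D x.
Proof.
move=> [p ->] [hs sB] x.
apply: (iff_trans _ (sat_automorphism (env_par (fun=> x)) p hs)).
by apply: eq_sat => -[//|b] /=; rewrite sB //; apply: (set_mem (valP b)).
Qed.

Lemma type_definable_aut_invariant (B X : set M) :
  type_definable_over S B X -> aut_invariant S B X.
Proof.
move=> [F FB ->]; apply/aut_invariantP => s hs x Fx D FD.
by apply/(definable_automorphism (FB _ FD) hs); apply: Fx.
Qed.

End Automorphisms.

Section Saturation.
Variables (K : Type) (L : language) (M : Type) (S : structure L M).
Hypothesis hG : monster_model K S.

Let hK : strong_limit K. Proof. by case: hG. Qed.

(** The partial elementary map has domain [B] together with the range of [w]. Each point of the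
    domain gets a name in [V + B], and its value is that name evaluated at [w']. *)
Lemma homogeneous_tuple V (w w' : V -> M) (B : set M) :
  small K B -> small K [set: V] ->
  (forall p : formula L (V + B),
     sat S (env_par w) p <-> sat S (env_par w') p) ->
  exists2 s, automorphism_over S B s & forall x, s (w x) = w' x.
Proof.
move=> sB sV ww'; have [_ _ _ hom] := hG.
pose B' := B `|` range w.
have /choice[g hg] (b : B') : exists y : V + B, env_par w y = val b.
  have [Bb|[x _ xb]] := set_mem (valP b); last by exists (inl x).
  by exists (inr (SigSub (mem_set Bb))).
(* The value is independent of the chosen name: that two names denote the same point is itself a
   formula, preserved from [w] to [w']. *)
have gE (b : B') (y : V + B) :
    val b = env_par w y -> env_par w' (g b) = env_par w' y.
  by rewrite -hg => /(ww' (Eq (Var (g b)) (Var y))).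
have sB' : small K B' by apply: small_setU => //; apply: small_image.
have [p|s hs sE] := hom _ (fun b => env_par w' (g b)) sB'.
  rewrite (_ : val = env_par w \o g); last by apply/funext => b; rewrite -hg.
  by rewrite -!sat_rename.
exists s.
  split=> // b Bb; have B'b : B' b by left.
  by rewrite (sE (SigSub (mem_set B'b))) (gE _ (inr (SigSub (mem_set Bb)))).
move=> x; have B'x : B' (w x) by right; exists x.
by rewrite (sE (SigSub (mem_set B'x))) (gE _ (inl x)).
Qed.

Lemma homogeneous1 (B : set M) a b : small K B ->
  (forall D, definable S B D -> D a -> D b) ->
  exists2 s, automorphism_over S B s & s a = b.
Proof.
move=> sB ab; have [//|p|s hs sE] :=
  @homogeneous_tuple unit (fun=> a) (fun=> b) B sB.
- by apply: small_countable => //; apply: countableP.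
- have h (q : formula L (unit + B)) : sat1 S q a -> sat1 S q b.
    by have := ab [set x | sat1 S q x] (ex_intro _ q erefl).
  split; first exact: h.
  by move=> pb; apply: contrapT => npa; apply: (h (Imp p Bot) npa pb).
- by exists s => //; apply: (sE tt).
Qed.

Lemma homogeneous2 (B : set M) a b c d : small K B ->
  (forall R, definable2 S B R -> R a b -> R c d) ->
  exists2 s, automorphism_over S B s & s a = c /\ s b = d.
Proof.
move=> sB ab; have [//|p|s hs sE] :=
  @homogeneous_tuple bool (fun i : bool => if i then b else a)
     (fun i : bool => if i then d else c) B sB.
- by apply: small_countable => //; apply: countableP.
- have h (q : formula L (bool + B)) : sat2 S q a b -> sat2 S q c d.
    by apply: (ab (sat2 S q)); apply/definable2P; exists q.
  split; first exact: h.
  by move=> pb; apply: contrapT => npa; apply: (h (Imp p Bot) npa pb).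
- by exists s => //; split; [apply: (sE false)|apply: (sE true)].
Qed.

(** Saturation restated for directed families of definable sets, which keeps formulas out of the
    later arguments. *)
Lemma compactness (B : set M) (I : Type) (P : set I) (F : I -> set M) :
  small K B -> (forall i, P i -> definable S B (F i)) -> directed P F ->
  (exists i, P i) ->
  (forall i, P i -> exists x, F i x) -> exists x, forall i, P i -> F i x.
Proof.
move=> sB dF dir [i0 Pi0] neF; have [_ _ sat _] := hG.
pose p := [set f : formula L (unit + B) |
  exists2 i, P i & F i = [set a | sat1 S f a]].
have [q fq qp|x hx] := sat B p sB; last first.
  exists x => i Pi; have [f Ff] := dF i Pi.
  by rewrite Ff; apply: hx; exists i.
have [|i j Pi Pj|f /qp[i Pi Ff]|i Pi Fi] := @finite_directed _ I P
    (fun i f => F i `<=` [set a | sat1 S f a]) q fq.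
- by exists i0.
- have [k Pk kij] := dir i j Pi Pj; exists k => // f [Ff|Ff] x /kij[? ?];
    exact: Ff.
- by exists i; rewrite // Ff.
by have [x Fx] := neF i Pi; exists x => f /Fi; apply.
Qed.

(** Saturation concerns one variable, so first [x] is realized in the projections, then [y] over [B]
    enlarged by [x]. *)
Lemma compactness2 (B : set M) (I : Type) (P : set I)
    (F : I -> M -> M -> Prop) :
  small K B -> (forall i, P i -> definable2 S B (F i)) ->
  (forall i j, P i -> P j -> exists2 k, P k &
    forall x y, F k x y -> F i x y /\ F j x y) ->
  (exists i, P i) ->
  (forall i, P i -> exists x y, F i x y) ->
  exists x y, forall i, P i -> F i x y.
Proof.
move=> sB dF dir Pn neF.
have [//|i Pi|i j Pi Pj|//|//|x hx] :=
  @compactness B I P (fun i x => exists y, F i x y).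
- apply/definableE/dpred_ex/(dpred_rel (dF i Pi)).
    dvar.
  dvar.
- have [k Pk kij] := dir i j Pi Pj; exists k => // x [y /kij[? ?]].
  by split; exists y.
have [|i Pi|i j Pi Pj|//|i Pi|y hy] :=
  @compactness (B `|` [set x]) I P (fun i y => F i x y).
- by apply: small_setU => //; apply/small_countable/finite_set_countable.
- apply/definableE; apply: (dpred_rel (definable2_sub _ (dF i Pi))).
  + by move=> b; left.
  + by apply: dterm_par; right.
  + dvar.
- by have [k Pk kij] := dir i j Pi Pj; exists k => // y /kij.
- exact: hx.
by exists x, y.
Qed.

End Saturation.

(** * Thick relations *)

(** Induction on [m], then on [n]. The tail is split by its relation to the head [x]; one class is
    long enough for the bound of [(m, n.+1)] or of [(m.+1, n)], and [x] extends the subsequence of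
    its own colour. *)
Lemma ramsey m n : exists N, forall (T : eqType) (e : rel T) (s : seq T),
  N <= size s ->
  (exists t, [/\ subseq t s, size t = m & pairwise e t]) \/
  (exists t, [/\ subseq t s, size t = n & pairwise (fun x y => ~~ e x y) t]).
Proof.
elim: m n => [n|m IHm].
  by exists 0 => T e s _; left; exists [::]; rewrite sub0seq.
elim=> [|n [N2 h2]].
  by exists 0 => T e s _; right; exists [::]; rewrite sub0seq.
have [N1 h1] := IHm n.+1.
exists (N1 + N2).+1 => T e [//|x s] /=; rewrite ltnS => hs.
have fs (p : pred T) (t : seq T) : subseq t (seq.filter p s) ->
    subseq (x :: t) (x :: s) /\ all p t.
  move=> tp; split; first by rewrite /= eqxx (subseq_trans tp) ?filter_subseq.
  by apply/allP => y /(mem_subseq tp); rewrite mem_filter => /andP[].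
have ws (p : pred T) (t : seq T) :
    subseq t (seq.filter p s) -> subseq t (x :: s).
  move=> tp; rewrite (subseq_trans tp) //.
  by rewrite (subseq_trans (filter_subseq _ _)) ?subseq_cons.
have [N1s|sN1] := leqP N1 (size (seq.filter (e x) s)).
  have [[t [ts tm et]]|[t [ts tn et]]] := h1 T e _ N1s.
    left; exists (x :: t); have [? at_] := fs _ _ ts.
    by rewrite /= tm at_ et; split.
  by right; exists t; split=> //; apply: ws ts.
have N2s : N2 <= size (seq.filter (fun y => ~~ e x y) s).
  rewrite leqNgt; apply: contraL hs => sN2; rewrite -ltnNge.
  rewrite -(count_predC (e x) s) -!size_filter.
  have := leq_add sN1 sN2; rewrite addSn addnS => /ltnW.
  by move=> h; apply: leq_trans h; rewrite ltnS.
have [[t [ts tm et]]|[t [ts tn et]]] := h2 T e _ N2s.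
  by left; exists t; split=> //; apply: ws ts.
right; exists (x :: t); have [? at_] := fs _ _ ts.
by rewrite /= tn at_ et; split.
Qed.

Section Groups.
Variable G : groupType.
Implicit Types H : set G.

Lemma subgroup1 H : is_subgroup H -> H 1%g. Proof. by case. Qed.
Lemma subgroupM H x y : is_subgroup H -> H x -> H y -> H (x * y)%g.
Proof. by case=> _ h _; apply: h. Qed.
Lemma subgroupV H x : is_subgroup H -> H x -> H (x^-1)%g.
Proof. by case=> _ _; apply. Qed.

Lemma left_coset_eq H x y : is_subgroup H ->
  left_coset H x = left_coset H y <-> H (x^-1 * y)%g.
Proof.
move=> hH; split=> [E|Hxy].
  have : left_coset H y y by exists 1%g; [apply: subgroup1|rewrite mulg1].
  by rewrite -E => -[h Hh <-]; rewrite mulKg.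
apply/seteqP; split=> _ [h Hh <-].
  exists ((x^-1 * y)^-1 * h)%g; last by rewrite invgM invgK !mulgA mulgV mul1g.
  by apply: subgroupM => //; apply: subgroupV.
exists (x^-1 * y * h)%g; last by rewrite !mulgA mulgV mul1g.
exact: subgroupM.
Qed.

Lemma coset_reps K H : is_subgroup H -> bounded_index K H ->
  exists2 C : set G, small K C & forall x, exists2 r, C r & H (r^-1 * x)%g.
Proof.
move=> hH bH.
have /choice[r hr] (D : set G) :
    exists x, left_cosets H D -> left_coset H x = D.
  by have [[x _ <-]|nD] := pselect (left_cosets H D); [exists x|exists 1%g].
exists (r @` left_cosets H); first exact: small_image.
move=> x; have lx : left_cosets H (left_coset H x) by exists x.
exists (r (left_coset H x)); first by exists (left_coset H x).
by apply/left_coset_eq => //; apply: hr.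
Qed.

Lemma bounded_index_sub K H H' : is_subgroup H -> is_subgroup H' -> H `<=` H' ->
  bounded_index K H -> bounded_index K H'.
Proof.
move=> hH hH' HH' bH; have [C sC hC] := coset_reps hH bH.
apply: small_sub (small_image (left_coset H') sC) => _ [x _ <-].
have [r Cr Hrx] := hC x; exists r => //; apply/left_coset_eq => //; exact: HH'.
Qed.

End Groups.

Section Thick.
Variables (L : group_language) (G : groupType) (S : structure L G).
Hypothesis hS : expands_group S.
Implicit Types B : set G.

Lemma automorphism_mul s x y : automorphism S s -> s (x * y)%g = (s x * s y)%g.
Proof.
move=> [_ sf _].
pose a (i : 'I_(farity (mul_sym L))) := if val i == 0 then x else y.
by have := sf _ a; rewrite !hS.
Qed.

Lemma automorphism_one s : automorphism S s -> s 1%g = 1%g.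
Proof.
by move=> hs; apply: (mulgI (s 1%g)); rewrite -automorphism_mul // !mulg1.
Qed.

Lemma automorphism_inv s x : automorphism S s -> s (x^-1)%g = (s x)^-1%g.
Proof.
move=> hs; apply: (mulgI (s x)); rewrite -automorphism_mul // !mulgV.
exact: automorphism_one.
Qed.

Lemma dterm_mul B E V (v : V -> E -> G) t u : dterm S B v t -> dterm S B v u ->
  dterm S B v (fun e => t e * u e)%g.
Proof.
move=> ht hu.
apply: (dpred_subst (P := fun e a => e.2 = (a * u e.1)%g)).
  exact: dterm_weaken.
apply: (dpred_subst (P := fun e a => e.1.2 = (e.2 * a)%g)).
  exact: dterm_weaken (dterm_weaken hu).
pose x (i : 'I_(farity (mul_sym L))) :
    term L (option (option (option V)) + B) :=
  Var (inl (if val i == 0 then Some None else None)).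
exists (Eq (Var (inl (Some (Some None)))) (App (mul_sym L) x)).
move=> [[[e a] b] c] /=.
by rewrite hS.
Qed.

(** The unit has no symbol either; it is described as the idempotent element [o], and the inverse by
    a product equal to [o]. *)
Lemma dterm_inv B E V (v : V -> E -> G) t :
  dterm S B v t -> dterm S B v (fun e => (t e)^-1)%g.
Proof.
move=> ht.
apply: (dpred_subst (P := fun e a => e.2 = (a^-1)%g)).
  exact: dterm_weaken.
have invE (e : E * G * G) : (exists o, (o * o = o)%g /\ (e.1.2 * e.2)%g = o) <->
    e.1.2 = (e.2^-1)%g.
  split=> [[o [oo Eo]]|->]; last by exists 1%g; rewrite mulg1 mulVg.
  have : (e.1.2 * e.2 = 1)%g by rewrite Eo; apply: (mulgI o); rewrite oo mulg1.
  by move=> h; apply: (mulIg e.2); rewrite h mulVg.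
apply: (dpred_ext invE); apply: dpred_ex.
apply: dpred_and; apply: dpred_eq.
- by apply: dterm_mul; apply: (@dterm_var _ _ S B _ _ _ (None)).
- exact: (@dterm_var _ _ S B _ _ _ (None)).
- apply: dterm_mul; first exact: (@dterm_var _ _ S B _ _ _ (Some (Some None))).
  exact: (@dterm_var _ _ S B _ _ _ (Some None)).
- exact: (@dterm_var _ _ S B _ _ _ (None)).
Qed.

(** Thickness of relations rather than of formulas, so that connectives of [Prop] apply directly;
    [ThetaP] gives the link to [Theta]. *)
Definition thick_rel B (R : G -> G -> Prop) : Prop :=
  [/\ definable2 S B R, forall a b, R a b <-> R b a
    & exists n, forall a : 'I_n -> G,
        exists i j : 'I_n, i < j /\ R (a i) (a j)].

Definition diffs (R : G -> G -> Prop) : set G :=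
  [set x | exists a b, R a b /\ x = (a^-1 * b)%g].

Lemma ThetaP B a b : Theta S B a b <-> forall R, thick_rel B R -> R a b.
Proof.
split=> [h R [/definable2P[p pR] Rsym [n hn]]|h p [ps [n hn]]].
  apply/pR; apply: h; split=> [x y|]; first by split=> /pR/Rsym/pR.
  by exists n => c; have [i [j [ij /pR]]] := hn c; exists i, j.
apply: (h (sat2 S p)); split=> //; first by apply/definable2P; exists p.
by exists n.
Qed.

Definition antichain (R : G -> G -> Prop) : rel G := fun x y => `[< ~ R x y >].

Lemma antichainP R x y : reflect (~ R x y) (antichain R x y).
Proof. exact: asboolP. Qed.

Lemma unavoidable_seqP (R : G -> G -> Prop) n :
  (forall a : 'I_n -> G, exists i j : 'I_n, i < j /\ R (a i) (a j)) <->
  (forall s : seq G, size s = n -> ~ pairwise (antichain R) s).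
Proof.
split=> [h s sn /(pairwiseP 1%g) ps|h a].
  have [i [j [ij]]] := h (fun i => nth 1%g s i).
  have io (k : 'I_n) : val k \in gtn (size s) by rewrite inE sn; apply: ltn_ord.
  by have /antichainP nR := ps i j (io i) (io j) ij; move=> /nR.
apply: contrapT => nR; apply: (h (mkseq (fun i => oapp a 1%g (insub i)) n)).
  by rewrite size_mkseq.
apply/(pairwiseP 1%g) => i j; rewrite !inE size_mkseq => iN jN ij.
rewrite !nth_mkseq // !insubT /= => Rij.
by apply: nR; exists (Sub i iN), (Sub j jN).
Qed.

Lemma thick_refl B R a : thick_rel B R -> R a a.
Proof. by move=> [_ _ [n /(_ (fun=> a))[i [j []]]]]. Qed.

Lemma thick_sub B B' R : B `<=` B' -> thick_rel B R -> thick_rel B' R.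
Proof. by move=> BB' [dR sR nR]; split=> //; apply: definable2_sub dR. Qed.

Lemma thick_True B : thick_rel B (fun _ _ => True).
Proof.
split=> //; first exact: dpred_True.
by exists 2 => a; exists ord0, ord_max.
Qed.

(** Ramsey: a long antichain of the conjunction contains either a long antichain of [R1] or a long
    subsequence on which [R1] always holds, hence an antichain of [R2]. *)
Lemma thick_and B R1 R2 : thick_rel B R1 -> thick_rel B R2 ->
  thick_rel B (fun a b => R1 a b /\ R2 a b).
Proof.
move=> [dR1 sR1 [m /unavoidable_seqP hm]] [dR2 sR2 [n /unavoidable_seqP hn]].
split; first exact: dpred_and.
  by move=> a b; rewrite sR1 sR2.
have [N hN] := ramsey m n; exists N.
apply/(unavoidable_seqP (fun a b => R1 a b /\ R2 a b)) => s sN ps.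
have [|[t [ts tm pt]]|[t [ts tn pt]]] := hN G (antichain R1) s.
- by rewrite sN.
- exact: hm tm pt.
apply: (hn t tn); have := subseq_pairwise ts ps; move: pt.
move=> p1 p2; have : pairwise (fun x y => ~~ antichain R1 x y &&
    antichain (fun a b => R1 a b /\ R2 a b) x y) t by rewrite pairwise_relI p1.
apply: sub_pairwise => x y /andP[/antichainP/contrapT R1xy /antichainP nR].
by apply/antichainP => R2xy; apply: nR.
Qed.

(** If no finite subset of [Y] covers it, antichains in [Y] can be extended one point at a time,
    beyond the length that thickness allows. *)
Lemma thick_cover B R (Y : set G) : thick_rel B R ->
  exists s : seq G, [set` s] `<=` Y /\
    forall y, Y y -> exists2 a, a \in s & R a y.
Proof.
move=> [_ _ [n /unavoidable_seqP hn]]; apply: contrapT => no.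
suff [s [sn _ ps]] : exists s : seq G,
    [/\ size s = n, [set` s] `<=` Y & pairwise (antichain R) s].
  exact: hn sn ps.
elim: n {hn} => [|n [s [sn sY ps]]]; first by exists [::].
have [y [Yy hy]] : exists y, Y y /\ forall a, a \in s -> ~ R a y.
  apply: contrapT => nex; apply: no; exists s; split=> // y Yy.
  apply: contrapT => h; apply: nex; exists y; split=> // a as_ Ray.
  by apply: h; exists a.
exists (rcons s y); split; first by rewrite size_rcons sn.
  by move=> x /=; rewrite mem_rcons inE => /orP[/eqP->|/sY].
rewrite pairwise_rcons ps andbT; apply/allP => a as_.
by apply/antichainP; apply: hy.
Qed.

(** The one property of a model used below. Small sets with this property are built directly in
    [small_covering], without constructing a small model. *)
Definition covering B B' : Prop := forall R, thick_rel B R ->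
  exists s : seq G, [set` s] `<=` B' /\ forall x, exists2 a, a \in s & R a x.

(** The Tarski-Vaught test: the existential sentence, expressed by [Imp], [Bot] and [All], passes to
    [M], and a witness found there is carried back. *)
Lemma elementary_submodel_meets (M : set G) D : elementary_submodel S M ->
  definable S M D -> (exists x, D x) -> exists2 x, M x & D x.
Proof.
move=> [SM hSM] [p ->] [x px].
pose q := frename (fun y : unit + M =>
  match y with inl _ => None | inr b => Some b end) p.
have : sat SM id (Imp (All (Imp q Bot)) Bot).
  apply/hSM => /= /(_ x); apply; rewrite sat_rename.
  by apply: (sat_eq _ px) => -[[]|].
move=> /= /existsNP[a /contrapT qa].
have : sat SM id (frename (env_cons id a) q).
  by rewrite sat_rename; apply: (sat_eq _ qa) => -[].
move=> /hSM; rewrite !sat_rename => pa; exists (val a).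
  exact: set_mem (valP a).
by apply: (sat_eq _ pa) => -[].
Qed.

(** A finite cover of [M] by points of [M] covers the whole group: the set of uncovered points is
    definable over [M], so if nonempty it would meet [M]. *)
Lemma elementary_submodel_covering A M : elementary_submodel S M -> A `<=` M ->
  covering A M.
Proof.
move=> hM AM R tR; have [s [sM hs]] := thick_cover M tR; exists s; split=> // x.
apply: contrapT => nx.
have [||y My ny] := @elementary_submodel_meets M
  [set y | forall a, a \in s -> ~ R a y] hM.
- have [/(definable2_sub AM) dR _ _] := tR; apply/definableE.
  elim: s sM {hs nx} => [|b s IH] sM.
    by apply: dpred_ext (dpred_True _ _ _) => y; split.
  have dIH : definable S M [set y | forall a, a \in s -> ~ R a y].
    by apply/definableE/IH => a as_; apply: sM; rewrite /= inE as_ orbT.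
  have dy : dterm S M (@var1 G) id by dvar.
  have Mb : M b by apply: sM; rewrite /= inE eqxx.
  have := dpred_and (dpred_not (dpred_rel dR (dterm_par _ _ Mb) dy))
    (dpred_definable dIH dy).
  apply: dpred_ext => y; split=> [[nb h] a|h].
    by rewrite inE => /orP[/eqP->|/h].
  by split=> [|a as_]; apply: h; rewrite inE ?eqxx ?as_ ?orbT.
- by exists x => a as_ Rax; apply: nx; exists a.
- by have [a as_ Ray] := hs y My; apply: ny as_ Ray.
Qed.

End Thick.

(** * Invariant subgroups of bounded index *)

Section DefinableSets.
Variables (L : language) (M : Type) (S : structure L M).
Implicit Types B C X D : set M.

Lemma definableC B D : definable S B D -> definable S B (~` D).
Proof. by move=> /definableE/dpred_not dD; apply/definableE. Qed.

Lemma definableI B D D' :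
  definable S B D -> definable S B D' -> definable S B (D `&` D').
Proof.
by move=> /definableE dD /definableE dD'; apply/definableE/dpred_and.
Qed.

Lemma definableT B : definable S B setT.
Proof. by apply/definableE/dpred_True. Qed.

Lemma type_definableP B X : type_definable_over S B X <->
  forall a, ~ X a -> exists D, [/\ definable S B D, X `<=` D & ~ D a].
Proof.
split=> [[F FB ->] a nFa|h]; last first.
  exists [set D | definable S B D /\ X `<=` D]; first by move=> D [].
  apply/seteqP; split=> [x Xx D [_]|x hx]; first exact.
  by apply: contrapT => /h[D [dD XD]]; apply; apply: hx.
have [D FD nDa] : exists2 D, F D & ~ D a.
  apply: contrapT => nD; apply: nFa => D FD.
  by apply: contrapT => nDa; apply: nD; exists D.
by exists D; split=> //; [apply: FB|apply: bigcap_inf].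
Qed.

Lemma tclosure_sub B X Y : X `<=` Y -> type_definable_over S B Y ->
  tclosure S B X `<=` Y.
Proof.
move=> XY /type_definableP dY x cx; apply: contrapT => /dY[D [dD YD]]; apply.
by apply: cx; split=> // y /XY/YD.
Qed.

Lemma type_definable_preimage B C (f : M -> M) X :
  (forall D, definable S B D -> definable S C (f @^-1` D)) ->
  type_definable_over S B X -> type_definable_over S C (f @^-1` X).
Proof.
move=> fD /type_definableP dX; apply/type_definableP => a /= /dX[D [dD XD nD]].
by exists (f @^-1` D); split=> //; [apply: fD|move=> x /XD].
Qed.

End DefinableSets.

Section Monster.
Variables (K : Type) (L : group_language) (G : groupType) (S : structure L G).
Hypotheses (hS : expands_group S) (hG : monster_model K S).
Implicit Types A B C X D H : set G.

Let hK : strong_limit K. Proof. by case: hG. Qed.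

Lemma small_set1 T (x : T) : small K [set x].
Proof. exact/(small_countable hK)/finite_set_countable. Qed.

(** If no [B]-definable set separates [a] from [X], compactness gives a point of [X] with the type
    of [a] over [B]. An automorphism over [B] then puts [a] in [X]. *)
Lemma type_definable_inv B C X : small K B -> small K C ->
  aut_invariant S B X -> type_definable_over S C X -> type_definable_over S B X.
Proof.
move=> sB sC iX tX; apply/type_definableP => a nXa; apply: contrapT => nD.
pose P := [set DE : set G * set G | [/\ definable S B DE.1, DE.1 a,
  definable S C DE.2 & X `<=` DE.2]].
have [|[D E] [/= dD Da dE XE]|||[D E] [/= dD Da dE XE]|b hb] :=
  @compactness K L G S hG (B `|` C) _ P (fun DE => DE.1 `&` DE.2).
- exact: small_setU.
- by apply: definableI; [apply: definable_sub dD|apply: definable_sub dE] => x;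
    [left|right].
- move=> [D E] [D' E'] [/= dD Da dE XE] [/= dD' Da' dE' XE'].
  exists (D `&` D', E `&` E'); last by move=> x [[? ?] [? ?]].
  by split=> /=; [apply: definableI|split|apply: definableI|
    move=> x Xx; split; [apply: XE|apply: XE']].
- by exists (setT, setT); split=> //=; apply: definableT.
- have [x Xx Dx] : exists2 x, X x & D x.
    apply: contrapT => nx; apply: nD; exists (~` D); split=> //.
      exact: definableC.
    by move=> x Xx Dx; apply: nx; exists x.
  by exists x; split=> //; apply: XE.
have [s hs sab] : exists2 s, automorphism_over S B s & s a = b.
  apply: (homogeneous1 hG sB) => D dD Da.
  by have [] := hb (D, setT); first by split=> //=; apply: definableT.
apply/nXa/(aut_invariantE _ iX hs); rewrite sab.
have /type_definableP dX := tX; apply: contrapT => /dX[E [dE XE]]; apply.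
by have [] := hb (setT, E); first by split=> //=; apply: definableT.
Qed.

Lemma definable_automorphism_preimage B D s s' :
  automorphism S s -> cancel s s' -> cancel s' s -> definable S B D ->
  definable S (s' @` B) (s @^-1` D).
Proof.
move=> hs sK s'K [p ->].
have s'B (b : B) : (s' @` B) (s' (val b)).
  by exists (val b) => //; apply: set_mem (valP b).
exists (frename (fun x => match x with
  | inl u => inl u | inr b => inr (SigSub (mem_set (s'B b))) end) p).
apply/seteqP; split=> x; rewrite /= /sat1 sat_rename => h.
  apply/(sat_automorphism _ _ hs); apply: (sat_eq _ h) => -[//|b] /=.
  by rewrite s'K.
move/(sat_automorphism _ _ hs): h.
by apply: sat_eq => -[//|b] /=; rewrite s'K.
Qed.

Lemma type_definable_automorphism X s : automorphism S s ->
  type_definable K S X -> type_definable K S (s @^-1` X).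
Proof.
move=> hs [B sB tX]; have [[s' sK s'K] _ _] := hs.
exists (s' @` B); first exact: small_image.
apply: type_definable_preimage tX => D.
exact: definable_automorphism_preimage.
Qed.

(** Two-sided, so that left translates, right translates and conjugates are all instances. *)
Lemma type_definable_mul X a b : type_definable K S X ->
  type_definable K S [set x | X (a * x * b)%g].
Proof.
move=> [B sB tX]; exists (B `|` ([set a] `|` [set b])).
  by do 2!apply: small_setU => //; apply: small_set1.
apply: (type_definable_preimage (f := fun x => (a * x * b)%g)) tX => D dD.
apply/definableE/(dpred_definable (definable_sub _ dD)).
  by move=> x; left.
apply: dterm_mul; [done| |by apply: dterm_par; right; right].
by apply: dterm_mul; [done|apply: dterm_par; right; left|dvar].
Qed.

Lemma type_definable_inverse X : type_definable K S X ->
  type_definable K S [set x | X (x^-1)%g].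
Proof.
move=> [B sB tX]; exists B => //.
apply: (type_definable_preimage (f := fun x => (x^-1)%g)) tX => D dD.
by apply/definableE/(dpred_definable dD)/dterm_inv => //; dvar.
Qed.

(** One finite cover is chosen for each thick formula over [B], and there are only a small number of
    formulas. *)
Lemma small_covering B : small K B ->
  exists C, [/\ small K C, B `<=` C & covering S B C].
Proof.
move=> sB.
have /choice[s hs] (p : formula L (bool + B)) : exists s : seq G,
    thick_rel S B (sat2 S p) -> forall x, exists2 a, a \in s & sat2 S p a x.
  have [tp|ntp] := pselect (thick_rel S B (sat2 S p)); last by exists [::].
  by have [s [_ hs]] := thick_cover setT tp; exists s => _ x; apply: hs.
pose f (q : formula L (bool + B) * nat) := nth 1%g (s q.1) q.2.
exists (B `|` range f); split.
- apply: small_setU => //; apply/small_image/small_prod => //.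
    apply: small_formula => //; first by case: hG.
    apply: small_sum => //; last exact: small_set_type.
    by apply/small_countable/countableP.
  exact: small_nat.
- by move=> x; left.
- move=> R tR; have [/definable2P[p pR] _ _] := tR.
  have {pR} E : sat2 S p = R.
    by apply/funext => a; apply/funext => b; apply/propext.
  exists (s p); split.
    move=> a /= /(nthP 1%g)[i _ <-]; right; by exists (p, i).
  by rewrite -E; apply: hs; rewrite E.
Qed.

Lemma thick_directed B R R' : thick_rel S B R -> thick_rel S B R' ->
  exists2 R'', thick_rel S B R'' & forall a b, R'' a b -> R a b /\ R' a b.
Proof.
by move=> tR tR'; exists (fun a b => R a b /\ R' a b); first exact: thick_and.
Qed.

(** For each thick [R] some [a] in [C] has [R a x]; this is a formula over [C], so [R a y] holds
    too. Compactness merges these witnesses into one [c]. *)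
Lemma covering_Theta B C x y : small K B -> B `<=` C -> covering S B C ->
  (forall D, definable S C D -> D x -> D y) ->
  exists c, Theta S B c x /\ Theta S B c y.
Proof.
move=> sB BC cC xy.
have [|R tR|R R' tR tR'||R tR|c hc] := @compactness K L G S hG
  (B `|` ([set x] `|` [set y])) _ (thick_rel S B)
  (fun R => [set c | R c x /\ R c y]).
- by do 2!apply: small_setU => //; apply: small_set1.
- have dR : definable2 S (B `|` ([set x] `|` [set y])) R.
    by have [dR _ _] := tR; apply: definable2_sub dR => z; left.
  apply/definableE/dpred_and; apply: (dpred_rel dR); try by dvar.
    by apply: dterm_par; right; left.
  by apply: dterm_par; right; right.
- have [R'' tR'' sub] := thick_directed tR tR'.
  exists R'' => // c [/sub[? ?] /sub[? ?]].
  by split.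
- by exists (fun _ _ => True); apply: thick_True.
- have [s [sC hs]] := cC R tR; have [a as_ Rax] := hs x; exists a; split=> //.
  apply: (xy [set z | R a z]) => //; have [dR _ _] := tR.
  apply/definableE/(dpred_rel (definable2_sub BC dR)); last by dvar.
  by apply: dterm_par; apply: sC.
by exists c; split; apply/ThetaP => R tR; have [] := hc R tR.
Qed.

Definition agree (s : seq (set G)) (x y : G) : Prop :=
  foldr (fun D P => (D x <-> D y) /\ P) True s.

Definition all_definable B (s : seq (set G)) : Prop :=
  foldr (fun D P => definable S B D /\ P) True s.

Lemma agree_cat s t x y : agree (s ++ t) x y <-> agree s x y /\ agree t x y.
Proof. by elim: s => /= [|D s ->]; tauto. Qed.

Lemma all_definable_cat B s t :
  all_definable B (s ++ t) <-> all_definable B s /\ all_definable B t.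
Proof. by elim: s => /= [|D s ->]; tauto. Qed.

Lemma agree_pigeonhole (s : seq (set G)) :
  exists n, forall a : 'I_n -> G,
    exists i j : 'I_n, i < j /\ agree s (a i) (a j).
Proof.
pose c x : (size s).-tuple bool := 
    map_tuple (fun D => `[< D x >]) (in_tuple s).
have cP x y : c x = c y -> agree s x y.
  move/(congr1 val); rewrite /c /=; elim: s {c} => //= D s IH [Dxy /IH ?].
  by split=> //; split=> /asboolP; [rewrite Dxy|rewrite -Dxy] => /asboolP.
exists #|{: (size s).-tuple bool}|.+1 => a.
have /injectivePn[i [j ij cij]] : ~~ injectiveb (c \o a).
  by apply/negP => /injectiveP/leq_card; rewrite card_ord ltnn.
have [lij|lji|/val_inj E] := ltngtP i j; last by rewrite E eqxx in ij.
- by exists i, j; split=> //; apply: cP.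
- by exists j, i; split=> //; apply/cP/esym.
Qed.

Lemma definable2_agree B s : all_definable B s -> definable2 S B (agree s).
Proof.
elim: s => [_|D s IH /= [dD ds]]; first exact: dpred_True.
apply: dpred_and; last exact: IH.
apply: dpred_and; apply: dpred_imp;
  by apply: dpred_definable => //; dvar.
Qed.

(* A pair with [Theta] starts arbitrarily long [tp(a, b / B)]-chains; by the
   pigeonhole principle two members of a chain agree on any finite set of
   formulas over coset representatives of [H], so by compactness some
   realization of [tp(a, b / B)] lies in a single coset. *)
Lemma Theta_subgroup B H a b : small K B -> is_subgroup H ->
  aut_invariant S B H -> bounded_index K H -> Theta S B a b -> H (a^-1 * b)%g.
Proof.
move=> sB hH iH bH /ThetaP Tab; apply: contrapT => nab.
have [C sC hC] := coset_reps hH bH.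
have sBC : small K (B `|` C) by apply: small_setU.
pose P := [set i : (G -> G -> Prop) * seq (set G) |
  [/\ definable2 S B i.1, i.1 a b & all_definable (B `|` C) i.2]].
have PT s : all_definable (B `|` C) s -> P ((fun _ _ => True), s).
  by move=> ds; split=> //; apply: dpred_True.
(* [R] is symmetrised because thick relations are symmetric; the orientation of the pair is
   recovered in [cases]. *)
have [|[R s] [/= dR Rab ds]|[R s] [R' s'] [/= dR Rab ds] [/= dR' Rab' ds']
    ||[R s] [/= dR Rab ds]|c [d cd]] :=
  @compactness2 K L G S hG (B `|` C) _ P
    (fun i x y => (i.1 x y \/ i.1 y x) /\ agree i.2 x y).
- by [].
- have dR' : definable2 S (B `|` C) R by apply: definable2_sub dR => x; left.
  apply: dpred_and; last exact: definable2_agree.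
  by apply: dpred_or; apply: (dpred_rel dR'); dvar.
- exists (fun x y => R x y /\ R' x y, s ++ s').
    by split=> //=; [apply: dpred_and|apply/all_definable_cat].
  by move=> x y /= [Rxy /agree_cat[]]; tauto.
- by exists ((fun _ _ => True), [::]); apply: PT.
- have [n hn] := agree_pigeonhole s.
  (* Were this complement thick, [Theta] would make it hold at [(a, b)], against [R a b]. *)
  have nt : ~ thick_rel S B (fun x y => ~ (R x y \/ R y x)).
    by move=> /Tab; apply; left.
  apply: contrapT => nex; apply: nt; split.
  + by apply: dpred_not; apply: dpred_or; [|apply: (dpred_rel dR); dvar].
  + by move=> x y; tauto.
  + exists n => f; have [i [j [ij fij]]] := hn f; exists i, j; split=> // Rf.
    by apply: nex; exists (f i), (f j).
(* An automorphism taking [c] to [d] fixes the coset representatives, so both points lie in the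
   coset of the same [r]. *)
have Hcd : H (c^-1 * d)%g.
  have [s hs scd] : exists2 s, automorphism_over S (B `|` C) s & s c = d.
    apply: (homogeneous1 hG sBC) => D dD Dc.
    by have [|_ [[+ _] _]] := cd ((fun _ _ => True), [:: D]); [apply: PT|apply].
  have [r Cr Hrc] := hC c.
  have Hrd : H (r^-1 * d)%g.
    have : H (s (r^-1 * c)%g).
      have /aut_invariantP iH' : aut_invariant S (B `|` C) H.
        by apply: aut_invariant_sub iH => x; left.
      exact: iH' hs _ Hrc.
    have [hs' sC'] := hs.
    rewrite (automorphism_mul hS) // (automorphism_inv hS) //.
    by rewrite sC' ?scd //; right.
  have -> : (c^-1 * d = (r^-1 * c)^-1 * (r^-1 * d))%g.
    by rewrite invgM invgK -!mulgA mulVKg.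
  by apply: subgroupM => //; apply: subgroupV.
(* If some [R] true of [(a, b)] fails at [(c, d)], conjoining it with any other such [R'] forces
   [R'] at [(d, c)]. *)
have cases : (forall R, definable2 S B R -> R a b -> R c d) \/
             (forall R, definable2 S B R -> R a b -> R d c).
  have [|/existsNP[R /not_implyP[dR /not_implyP[Rab nRcd]]]] :=
    pselect (forall R, definable2 S B R -> R a b -> R c d); first by left.
  right=> R' dR' Rab'.
  have [|[[//]|[]//] _] := cd (fun x y => R x y /\ R' x y, [::]).
  by split=> //; apply: dpred_and.
case: cases => [/(homogeneous2 hG sB)|/(homogeneous2 hG sB)] [s hs [sa sb]];
  apply/nab/(aut_invariantE _ iH hs); have [hs' _] := hs;
  rewrite (automorphism_mul hS) // (automorphism_inv hS) // sa sb //.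
by have := subgroupV hH Hcd; rewrite invgM invgK.
Qed.

Lemma covering_subgroup B C H x y : small K B -> B `<=` C -> covering S B C ->
  is_subgroup H -> (forall a b, Theta S B a b -> H (a^-1 * b)%g) ->
  (forall D, definable S C D -> D x -> D y) -> H (x^-1 * y)%g.
Proof.
move=> sB BC cC hH TH xy; have [c [Tcx Tcy]] := covering_Theta sB BC cC xy.
have -> : (x^-1 * y = (c^-1 * x)^-1 * (c^-1 * y))%g.
  by rewrite invgM invgK -!mulgA mulVKg.
by apply: subgroupM => //; [apply: subgroupV => //|]; apply: TH.
Qed.

(** Distinct cosets have representatives with distinct types over a small covering set, so sets of
    formulas bound the index. *)
Lemma bounded_index_Theta B H : small K B -> is_subgroup H ->
  (forall a b, Theta S B a b -> H (a^-1 * b)%g) -> bounded_index K H.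
Proof.
move=> sB hH TH; have [C [sC BC cC]] := small_covering sB.
have /choice[r hr] (D : set G) :
    exists x, left_cosets H D -> left_coset H x = D.
  by have [[x _ <-]|nD] := pselect (left_cosets H D); [exists x|exists 1%g].
apply: (@small_inj K _ _ _ [set: set (formula L (unit + C))]
  (fun D => [set p | sat1 S p (r D)])) => //.
  move=> D E /set_mem lD /set_mem lE DE; rewrite -(hr D lD) -(hr E lE).
  apply/left_coset_eq => //; apply: (covering_subgroup sB BC cC hH TH).
  by move=> X [p ->] pD; have : [set p | sat1 S p (r D)] p by []; rewrite DE.
apply/small_set/small_formula => //; first by case: hG.
apply: small_sum => //; last exact: small_set_type.
by apply/small_countable/countableP.
Qed.

(** * The component G^inf: bounded index, normality, and unions of its cosets *)

Section Ginf.
Variable A : set G.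
Hypothesis sA : small K A.

Local Notation Ginf := (Ginf K S A).

Lemma Ginf_subgroup : is_subgroup Ginf.
Proof.
split=> [H [/subgroup1//]|x y Gx Gy H hH|x Gx H hH]; have [sH _ _] := hH.
- by apply: subgroupM => //; [apply: Gx|apply: Gy].
- by apply: subgroupV => //; apply: Gx.
Qed.

Lemma Ginf_sub H : is_subgroup H -> aut_invariant S A H -> bounded_index K H ->
  Ginf `<=` H.
Proof. by move=> hH iH bH; apply: bigcap_inf. Qed.

Lemma Ginf_invariant : aut_invariant S A Ginf.
Proof.
apply/aut_invariantP => s hs x Gx H hH; have [_ iH _] := hH.
by apply/(aut_invariantE _ iH hs); apply: Gx.
Qed.

Lemma Theta_Ginf a b : Theta S A a b -> Ginf (a^-1 * b)%g.
Proof. by move=> Tab H [hH iH bH]; apply: Theta_subgroup Tab. Qed.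

Lemma Ginf_bounded : bounded_index K Ginf.
Proof. exact: bounded_index_Theta sA Ginf_subgroup Theta_Ginf. Qed.

Lemma conjugate_subgroup H g : is_subgroup H ->
  is_subgroup [set x | H (g^-1 * x * g)%g].
Proof.
move=> hH; split=> [|x y Hx Hy|x Hx] /=.
- by rewrite mulg1 mulVg; apply: subgroup1.
- have := subgroupM hH Hx Hy.
  by rewrite -!mulgA mulVKg.
- by have := subgroupV hH Hx; rewrite !invgM invgK mulgA.
Qed.

Lemma conjugate_bounded H g : is_subgroup H -> bounded_index K H ->
  bounded_index K [set x | H (g^-1 * x * g)%g].
Proof.
move=> hH bH; have [C sC hC] := coset_reps hH bH.
pose H' := [set x | H (g^-1 * x * g)%g].
apply: small_sub (small_image (fun c => left_coset H' (c * g^-1)%g) sC).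
move=> _ [x _ <-].
have [c Cc Hc] := hC (x * g)%g; exists c => //.
apply/left_coset_eq; first exact: conjugate_subgroup.
by rewrite /H' /= invgM invgK -!mulgA mulKg.
Qed.

(** The normal core of each admissible [H] is itself admissible. For its index, a conjugate of [H]
    depends only on a coset, so conjugates by a small set [C] of representatives suffice; these are
    invariant over [A] with [C], hence contain all [Theta]-differences over that set. *)
Lemma Ginf_normal : is_normal Ginf.
Proof.
split=> [|g h Gh H [hH iH bH]]; first exact: Ginf_subgroup.
pose core := [set x | forall g, H (g^-1 * x * g)%g].
have hcore : is_subgroup core.
  split=> [k|x y cx cy k|x cx k]; have hk := conjugate_subgroup k hH.
  - exact: subgroup1 hk.
  - by apply: (subgroupM hk); [apply: cx|apply: cy].
  - by apply: (subgroupV hk); apply: cx.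
suff /(_ _ Gh (g^-1)%g) : Ginf `<=` core by rewrite invgK.
apply: Ginf_sub => //.
  apply/aut_invariantP => s hs x cx k; have [hs' _] := hs.
  have [s' _ [sK s'K]] := automorphism_over_inv hs.
  rewrite -(s'K k) -(automorphism_inv hS) // -!(automorphism_mul hS) //.
  by apply/(aut_invariantE _ iH hs); apply: cx.
have [C sC hC] := coset_reps hH bH.
apply: (@bounded_index_Theta (A `|` C)) => //; first exact: small_setU.
move=> a b Tab k; have [r Cr Hrk] := hC k.
have Hr : H (r^-1 * (a^-1 * b) * r)%g.
  have hr := conjugate_subgroup r hH.
  apply: (Theta_subgroup _ hr _ (conjugate_bounded r hH bH) Tab).
    exact: small_setU.
  apply/aut_invariantP => s hs x /= Hx; have [hs' sC'] := hs.
  have -> : (r^-1 * s x * r = s (r^-1 * x * r))%g.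
    rewrite !(automorphism_mul hS) // (automorphism_inv hS) //.
    by rewrite (sC' r) //; right.
  have /aut_invariantP iH' : aut_invariant S (A `|` C) H.
    by apply: aut_invariant_sub iH => y; left.
  exact: iH' hs _ Hx.
have -> : (k^-1 * (a^-1 * b) * k =
    (r^-1 * k)^-1 * (r^-1 * (a^-1 * b) * r) * (r^-1 * k))%g.
  by rewrite invgM invgK -!mulgA !mulVKg.
by do 2!apply: subgroupM => //; apply: subgroupV.
Qed.

Definition Ginf_stable X : Prop := forall x g, X x -> Ginf g -> X (x * g)%g.

(** An automorphism over [N] preserves types over [N], so it moves points within cosets of [Ginf];
    thus [X] is [N]-invariant and its parameters can be moved into [N]. *)
Lemma type_definable_Ginf_stable X N : small K N -> A `<=` N ->
  covering S A N -> Ginf_stable X -> type_definable K S X ->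
  type_definable_over S N X.
Proof.
move=> sN AN cN stX [B sB tX]; apply: (type_definable_inv sN sB _ tX).
apply/aut_invariantP => s hs x Xx; rewrite -[s x](mulVKg x); apply: stX => //.
apply: (covering_subgroup sA AN cN Ginf_subgroup Theta_Ginf) => D dD.
by rewrite (definable_automorphism dD hs).
Qed.

End Ginf.
End Monster.

(** * The closure of an invariant subgroup *)

Section Hull.
Variables (K : Type) (L : group_language) (G : groupType) (S : structure L G).
Hypotheses (hS : expands_group S) (hG : monster_model K S).
Variable A : set G.
Hypothesis sA : small K A.
Implicit Types B C X D H N : set G.

Let hK : strong_limit K. Proof. by case: hG. Qed.
Local Notation Ginf := (Ginf K S A).
Local Notation Ginf_stable := (Ginf_stable K S A).

(** The preimage of the closure of the image of [H], described inside the group; [quot_closureE]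
    proves the agreement. *)
Definition hull N H : set G := \bigcap_(X in [set X |
  [/\ type_definable_over S N X, Ginf_stable X & H `<=` X]]) X.

Lemma type_definable_over_hull N H : type_definable_over S N (hull N H).
Proof.
apply/type_definableP => a nha; have [X [tX stX HX] nXa] : exists2 X,
    [/\ type_definable_over S N X, Ginf_stable X & H `<=` X] & ~ X a.
  apply: contrapT => no; apply: nha => X hX; apply: contrapT => nXa.
  by apply: no; exists X.
have /type_definableP/(_ a nXa)[D [dD XD nDa]] := tX; exists D; split=> //.
by move=> x hx; apply: XD; apply: hx.
Qed.

Lemma hull_stable N H : Ginf_stable (hull N H).
Proof.
move=> x g hx Gg X hX; have [_ stX _] := hX.
by apply: stX => //; apply: hx.
Qed.

Lemma sub_hull N H : H `<=` hull N H.
Proof. by move=> x Hx X [_ _]; apply. Qed.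

Section Subgroup.
Variables (N H : set G).
Hypotheses (sN : small K N) (AN : A `<=` N) (cN : covering S A N).
Hypotheses (hH : is_subgroup H) (GH : Ginf `<=` H).

Lemma type_definable_hull : type_definable K S (hull N H).
Proof. by exists N => //; apply: type_definable_over_hull. Qed.

Lemma hull_min X : type_definable K S X -> Ginf_stable X -> H `<=` X ->
  hull N H `<=` X.
Proof.
move=> tX stX HX; apply: bigcap_inf; split=> //.
exact: (type_definable_Ginf_stable hS hG sA sN AN cN stX tX).
Qed.

(** As for the closure of a subgroup of a topological group: minimality is applied to left
    translates by elements of [H], then to right translates by elements of the hull, then to the
    inverse. Normality of [Ginf] keeps the right translates and the inverse stable. *)
Lemma hull_subgroup : is_subgroup (hull N H).
Proof.
have [gG nG] := Ginf_normal hS hG sA.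
have mulHT h t : H h -> hull N H t -> hull N H (h * t)%g.
  move=> Hh; pose X := [set x | hull N H (h * x * 1)%g].
  have : hull N H `<=` X.
    apply: hull_min; first exact: type_definable_mul type_definable_hull.
      by move=> x g + Gg; rewrite /X /= !mulg1 mulgA => hx; apply: hull_stable.
    by move=> x Hx; rewrite /X /= mulg1; apply: sub_hull; apply: subgroupM.
  by move=> /(_ t) + ht => /(_ ht); rewrite /X /= mulg1.
split.
- by apply: sub_hull; apply: subgroup1.
- move=> s t hs ht; pose X := [set x | hull N H (1 * x * t)%g].
  have : hull N H `<=` X.
    apply: hull_min; first exact: type_definable_mul type_definable_hull.
      move=> x g; rewrite /X /= => hx Gg.
      have -> : (1 * (x * g) * t = 1 * x * t * (t^-1 * g * t))%g.
        by rewrite -!mulgA mulVKg.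
      apply: hull_stable => //.
      by have := nG (t^-1)%g g Gg; rewrite invgK.
    by move=> h Hh; rewrite /X /= mul1g; apply: mulHT.
  by move=> /(_ s hs); rewrite /X /= mul1g.
- have : hull N H `<=` [set x | hull N H (x^-1)%g].
    apply: hull_min; first exact: type_definable_inverse type_definable_hull.
      move=> x g /= hx Gg; rewrite invgM.
      have -> : (g^-1 * x^-1 = x^-1 * (x * g^-1 * x^-1))%g.
        by rewrite -!mulgA mulKg.
      by apply: hull_stable => //; apply: nG; apply: subgroupV gG Gg.
    by move=> h Hh /=; apply: sub_hull; apply: subgroupV.
  by move=> h x hx; apply: h.
Qed.

Lemma hull_least X : is_subgroup X -> type_definable K S X -> H `<=` X ->
  hull N H `<=` X.
Proof.
move=> hX tX HX; apply: hull_min => // x g Xx Gg.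
by apply: subgroupM => //; apply/HX/GH.
Qed.

(** The preimage of the hull under conjugation by [g] is a type-definable subgroup containing [H],
    so it contains the hull. *)
Lemma hull_normal : is_normal H -> is_normal (hull N H).
Proof.
move=> [_ nH]; split; first exact: hull_subgroup.
move=> g h; have tT := type_definable_mul hS hG g (g^-1)%g type_definable_hull.
apply: (hull_least _ tT) => [|x Hx]; last by apply: sub_hull; apply: nH.
have := conjugate_subgroup (g^-1)%g hull_subgroup; rewrite invgK; exact.
Qed.

(** Leastness also makes the hull invariant under automorphisms over [A], which lets the parameters
    descend from [N] to [A]. *)
Lemma type_definable_base_hull :
  aut_invariant S A H -> type_definable_over S A (hull N H).
Proof.
move=> iH.
apply: (type_definable_inv hG sA sN); last exact: type_definable_over_hull.
apply/aut_invariantP => s hs x.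
have [hs' _] := hs.
have tT := type_definable_automorphism hs' type_definable_hull.
apply: (hull_least _ tT) => [|h Hh].
  split=> [|y z|y] /=; have hT := hull_subgroup.
  - by rewrite (automorphism_one hS) //; apply: subgroup1.
  - by rewrite (automorphism_mul hS) //; apply: subgroupM.
  - by rewrite (automorphism_inv hS) //; apply: subgroupV.
by apply: sub_hull; apply/(aut_invariantE _ iH hs).
Qed.

End Subgroup.
End Hull.

(** * Thick neighbourhoods and the hull of a normal subgroup *)

Section Neighbourhoods.
Variables (K : Type) (L : group_language) (G : groupType) (S : structure L G).
Hypotheses (hS : expands_group S) (hG : monster_model K S).
Implicit Types B C X D H N : set G.
Let hK : strong_limit K. Proof. by case: hG. Qed.

Lemma diffsE (R : G -> G -> Prop) x : diffs R x <-> exists a, R a (a * x)%g.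
Proof.
split=> [[a [b [Rab ->]]]|[a Ra]]; first by exists a; rewrite mulVKg.
by exists a, (a * x)%g; rewrite mulKg.
Qed.

Lemma diffs1 B R : thick_rel S B R -> diffs R 1%g.
Proof.
by move=> tR; apply/diffsE; exists 1%g; rewrite mulg1; apply: thick_refl tR.
Qed.

Lemma diffsV B R x : thick_rel S B R -> diffs R x -> diffs R (x^-1)%g.
Proof.
by move=> [_ sR _] [a [b [/sR Rab ->]]]; exists b, a; rewrite invgM invgK.
Qed.

Lemma definable_diffs B R : definable2 S B R -> definable S B (diffs R).
Proof.
move=> dR; apply/definableE.
apply: (@dpred_ext _ _ _ _ _ _ _ (fun x => exists a, R a (a * x)%g)).
  by move=> x; rewrite diffsE.
by apply/dpred_ex/(dpred_rel dR); [|apply: dterm_mul => //]; dvar.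
Qed.

(** Compactness exchanges the quantifiers: a base point [a] for each [R] becomes one for all [R]. *)
Lemma XTheta_diffs B x : small K B ->
  (forall R, thick_rel S B R -> diffs R x) -> XTheta S B x.
Proof.
move=> sB hx.
have [|R tR|R R' tR tR'||R tR|a ha] := @compactness K L G S hG
  (B `|` [set x]) _ (thick_rel S B) (fun R => [set a | R a (a * x)%g]).
- by apply: small_setU => //; apply: small_set1 hG _ _.
- have dR : definable2 S (B `|` [set x]) R.
    by have [dR _ _] := tR; apply: definable2_sub dR => z; left.
  apply/definableE/(dpred_rel dR); first by dvar.
  by apply: dterm_mul => //; [dvar|apply: dterm_par; right].
- have [R'' tR'' sub] := thick_directed tR tR'.
  by exists R'' => // a /sub.
- by exists (fun _ _ => True); apply: thick_True.
- exact/diffsE/hx.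
exists a, (a * x)%g; rewrite mulKg; split=> //.
by apply/ThetaP => R tR; apply: ha tR.
Qed.

Lemma XTheta_subgroup B H x : small K B -> is_subgroup H ->
  aut_invariant S B H -> bounded_index K H -> XTheta S B x -> H x.
Proof.
by move=> sB hH iH bH [a [b [Tab ->]]]; apply: (Theta_subgroup hS hG sB).
Qed.

(** Otherwise compactness yields [x] and [y] in [XTheta] with product in [Y]; both lie in [H], and
    so does their product. *)
Lemma thick_avoid B H Y : small K B -> is_subgroup H -> aut_invariant S B H ->
  bounded_index K H -> definable S B Y -> (forall h, H h -> ~ Y h) ->
  exists2 R, thick_rel S B R &
    forall x y, diffs R x -> diffs R y -> ~ Y (x * y)%g.
Proof.
move=> sB hH iH bH dY HY; apply: contrapT => no.
have [//|R [dR _ _]|R R' tR tR'||R tR|x [y xy]] := @compactness2 K L G S hG B _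
  (thick_rel S B) (fun R x y => [/\ diffs R x, diffs R y & Y (x * y)%g]).
- apply: (@dpred_ext _ _ _ _ _ _ _ (fun e => (diffs R e.1 /\ diffs R e.2) /\
    Y (e.1 * e.2)%g)); first by move=> e; split=> [[[? ?] ?]|[? ? ?]].
  have dD := definable_diffs dR; apply: dpred_and.
    by apply: dpred_and; apply: (dpred_definable dD); dvar.
  by apply: (dpred_definable dY); apply: dterm_mul => //; dvar.
- have [R'' tR'' sub] := thick_directed tR tR'; exists R'' => // x y.
  move=> [/diffsE[a /sub[Ra R'a]] /diffsE[b /sub[Rb R'b]] Yxy].
  by split; split=> //; apply/diffsE; [exists a|exists b|exists a|exists b].
- by exists (fun _ _ => True); apply: thick_True.
- apply: contrapT => nex; apply: no; exists R => // x y Rx Ry Yxy.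
  by apply: nex; exists x, y.
have [_ _ Yxy] := xy _ (thick_True S B).
have TH z : (forall R, thick_rel S B R -> diffs R z) -> H z.
  by move=> hz; apply: (XTheta_subgroup sB) => //; apply: XTheta_diffs.
apply: (HY _ _ Yxy); apply: subgroupM => //; apply: TH => R tR;
  by have [] := xy R tR.
Qed.

Lemma definable_seq B (t : seq G) (F : G -> set G) :
  (forall a, a \in t -> definable S B (F a)) ->
  definable S B [set z | exists2 a, a \in t & F a z].
Proof.
elim: t => [|a t IH] dF.
  have -> : [set z | exists2 a, a \in [::] & F a z] = ~` setT.
    by apply/seteqP; split=> [z [a]|z /=]; [rewrite in_nil|case].
  exact/definableC/definableT.
have -> : [set z | exists2 b, b \in a :: t & F b z] =
    ~` (~` F a `&` ~` [set z | exists2 b, b \in t & F b z]).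
  apply/seteqP; split=> z.
    move=> [b]; rewrite inE => /orP[/eqP->|bt] Fz [nF nt] //.
    by apply: nt; exists b.
  move=> /not_andP[/contrapT Fa|/contrapT[b bt Fb]].
    by exists a; rewrite // inE eqxx.
  by exists b; rewrite // inE bt orbT.
apply/definableC/definableI; apply: definableC.
  by apply: dF; rewrite inE eqxx.
by apply: IH => b bt; apply: dF; rewrite inE bt orbT.
Qed.

Section NormalSubgroup.
Variables (A H : set G).
Hypotheses (sA : small K A) (nH : is_normal H).
Hypotheses (iH : aut_invariant S A H) (bH : bounded_index K H).

Let hH : is_subgroup H. Proof. by case: nH. Qed.

(** Extra parameters are needed because the refinement in [finitely_thick_square] is found over
    points chosen along the way; [H] remains invariant over the enlarged set. *)
Definition finitely_thick (R : G -> G -> Prop) : Prop :=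
  exists s : seq G, thick_rel S (A `|` [set` s]) R.

Lemma small_adjoin (s : seq G) : small K (A `|` [set` s]).
Proof.
by apply: small_setU => //; apply/(small_countable hK)/finite_set_countable.
Qed.

Lemma invariant_adjoin (s : seq G) : aut_invariant S (A `|` [set` s]) H.
Proof. by apply: aut_invariant_sub iH => x; left. Qed.

Lemma set_mul_normal X h x :
  H h -> set_mul H X x -> set_mul H X (h * x)%g.
Proof.
move=> Hh [k Hk [y Xy <-]]; exists (h * k)%g; first exact: subgroupM.
by exists y => //; rewrite mulgA.
Qed.

(* Otherwise one builds an infinite sequence [a_0, a_1, ...] outside
   [H * diffs R] by taking [a_n] in [diffs R' * diffs R'] with [R'] so fine
   that this set avoids all [a_i * diffs R] for [i < n]; the differences
   [a_i^-1 * a_n] then avoid [diffs R], against thickness. *)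
Lemma finitely_thick_square R : finitely_thick R ->
  exists2 R', finitely_thick R' &
    forall x y, diffs R' x -> diffs R' y -> set_mul H (diffs R) (x * y)%g.
Proof.
move=> [s tR]; apply: contrapT => no.
have [dR sR [n /unavoidable_seqP hn]] := tR.
suff [t [tn _ pt]] : exists t : seq G, [/\ size t = n,
    forall a, a \in t -> ~ set_mul H (diffs R) a & pairwise (antichain R) t].
  exact: hn tn pt.
elim: n {hn} => [|n [t [tn tH pt]]]; first by exists [::].
pose B := A `|` [set` s ++ t].
have sB : A `|` [set` s] `<=` B.
  by move=> x [?|/= xs]; [left|right; rewrite /= mem_cat xs].
have dY : definable S B [set z | exists2 a, a \in t & diffs R (a^-1 * z)%g].
  apply: definable_seq => a ta.
  apply/definableE/(dpred_definable (definable_diffs (definable2_sub sB dR))).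
  apply: dterm_mul => //; last by dvar.
  apply: dterm_inv => //; apply: dterm_par.
  by right; rewrite /= mem_cat ta orbT.
(* If [a^-1 * h] were in [diffs R], so would be its inverse, and [a] would be [h] times that
   inverse, inside [H * diffs R]. *)
have HY h : H h -> ~ exists2 a, a \in t & diffs R (a^-1 * h)%g.
  move=> Hh [a ta /(diffsV tR) Rah]; apply: (tH a ta).
  by exists h => //; exists (a^-1 * h)^-1%g => //; rewrite invgM invgK mulVKg.
have [R' tR' avoid] :=
  thick_avoid (small_adjoin _) hH (@invariant_adjoin _) bH dY HY.
have [x [y [Rx Ry nHxy]]] : exists x y,
    [/\ diffs R' x, diffs R' y & ~ set_mul H (diffs R) (x * y)%g].
  apply: contrapT => nex; apply: no; exists R'; first by exists (s ++ t).
  by move=> x y Rx Ry; apply: contrapT => nxy; apply: nex; exists x, y.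
exists (rcons t (x * y)%g); split; first by rewrite size_rcons tn.
  by move=> a; rewrite mem_rcons inE => /orP[/eqP->|/tH].
rewrite pairwise_rcons pt andbT; apply/allP => a ta; apply/antichainP => Raxy.
apply: (avoid x y Rx Ry); exists a => //.
by apply/diffsE; exists a; rewrite mulVKg.
Qed.

(** The interior of [H * diffs R] when the sets [g * diffs R'] serve as basic neighbourhoods of
    [g]. *)
Definition thick_interior (R : G -> G -> Prop) : set G := [set g |
  exists2 R', finitely_thick R' &
    forall x, diffs R' x -> set_mul H (diffs R) (g * x)%g].

Lemma thick_interior_mull R h g :
  H h -> thick_interior R g -> thick_interior R (h * g)%g.
Proof.
move=> Hh [R' tR' hR']; exists R' => // x /hR' hx.
by rewrite -mulgA; apply: set_mul_normal.
Qed.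

Lemma thick_interior_mulr R h g :
  H h -> thick_interior R g -> thick_interior R (g * h)%g.
Proof.
move=> Hh Rg.
have -> : (g * h = g * h * g^-1 * g)%g by rewrite -mulgA mulVg mulg1.
by apply: thick_interior_mull => //; case: nH => _; apply.
Qed.

(** [R'] is refined twice by [finitely_thick_square], and normality moves the factors from [H] to
    the left of [g]. Two factors appear because a cover links two points through a common
    neighbour. *)
Lemma thick_interior_open R g : thick_interior R g ->
  exists2 R', finitely_thick R' &
  forall x y, diffs R' x -> diffs R' y -> thick_interior R (g * x * y)%g.
Proof.
move=> [R' tR' hR']; have [R1 tR1 hR1] := finitely_thick_square tR'.
have [R2 tR2 hR2] := finitely_thick_square tR1; exists R2 => // x y R2x R2y.
exists R1 => // z R1z; have [h Hh [u R1u E]] := hR2 x y R2x R2y.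
have [k Hk [v R'v E']] := hR1 u z R1u R1z.
have -> : (g * x * y * z = g * (h * k) * g^-1 * (g * v))%g.
  rewrite -(mulgA g) -E -!mulgA -E' mulKg.
  by rewrite !mulgA.
apply: set_mul_normal; last exact: hR'.
by case: nH => _; apply; apply: subgroupM.
Qed.

(** The interior is a union of cosets of [H], so one neighbourhood for each representative suffices
    and the parameters stay small in number. *)
Lemma type_definable_thick_interiorC R :
  type_definable K S (~` thick_interior R).
Proof.
have [C sC hC] := coset_reps hH bH.
(* The list [w r] holds both the extra parameters of [R'] and a finite [R']-cover of the group. *)
have /choice[w hw] (r : G) : exists w : seq G, thick_interior R r ->
    exists R' : G -> G -> Prop, [/\ thick_rel S (A `|` [set` w]) R',
      forall z, exists2 a, a \in w & R' a z &
      forall x y, diffs R' x -> diffs R' y -> thick_interior R (r * x * y)%g].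
  have [Rr|nRr] := pselect (thick_interior R r); last by exists [::].
  have [R' [s tR'] hR'] := thick_interior_open Rr.
  have [t [_ ht]] := thick_cover setT tR'.
  exists (s ++ t) => _; exists R'; split=> //.
    by apply: thick_sub tR' => x [?|/= xs]; [left|right; rewrite /= mem_cat xs].
  move=> z; have [a ta Raz] := ht z I.
  by exists a => //; rewrite mem_cat ta orbT.
pose B := A `|` [set nth 1%g (w q.1) q.2 | q in [set q : G * nat | C q.1]].
have wB r : C r -> A `|` [set` w r] `<=` B.
  move=> Cr x [?|/= /(nthP 1%g)[i _ <-]]; first by left.
  by right; exists (r, i).
exists B.
  apply: small_setU => //; apply: small_image.
  have := small_image (fun q : C * nat => (val q.1, q.2))
    (small_prod hK (small_set_type sC) (small_nat hK)).
  apply: small_sub => -[r i] /= Cr.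
  by exists (SigSub (mem_set Cr), i).
apply/type_definableP => x /contrapT Rx.
have [r Cr Hrx] := hC x.
have Rr : thick_interior R r.
  have -> : (r = x * (r^-1 * x)^-1)%g by rewrite invgM invgK mulVKg.
  by apply: thick_interior_mulr => //; apply: subgroupV.
have [R' [tR' cov hR']] := hw r Rr; have [a wa Rax] := cov x.
exists (~` [set z | R' a z]); split.
- have [dR' _ _] := tR'.
  apply/definableC/definableE/(dpred_rel (definable2_sub (wB r Cr) dR')).
    by apply: dterm_par; apply: (wB r Cr); right.
  by dvar.
- move=> z nRz Raz; apply: nRz.
  have Dax : diffs R' (a^-1 * x)%g by apply/diffsE; exists a; rewrite mulVKg.
  have Daz : diffs R' (a^-1 * z)%g by apply/diffsE; exists a; rewrite mulVKg.
  (* This puts [r * x^-1 * z] in the interior; multiplying on the left by [x * r^-1], an element of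
     [H], gives [z]. *)
  have := hR' _ _ (diffsV tR' Dax) Daz.
  rewrite invgM invgK -!mulgA mulVKg => Rz.
  have Hxr : H (x * r^-1)%g.
    by have := (proj2 nH) r _ Hrx; rewrite !mulgA mulgV mul1g.
  have := thick_interior_mull Hxr Rz; by rewrite -!mulgA mulKg mulVKg.
- by apply.
Qed.

Hypothesis GH : Ginf K S A `<=` H.
Variable N : set G.
Hypotheses (sN : small K N) (AN : A `<=` N) (cN : covering S A N).
Local Notation hull := (hull K S A N H).

(** If [c] in the hull missed the interior, the set of [x] with [c * x] outside the interior would
    be type-definable, stable and contain [H]. It would then contain [c^-1], although [1] is
    interior. *)
Lemma hull_thick R : thick_rel S A R -> hull `<=` set_mul H (diffs R).
Proof.
move=> tR; have fR : finitely_thick R.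
  by exists [::]; apply: thick_sub tR => x; left.
suff sub : hull `<=` thick_interior R.
  move=> t /sub[R' [s tR'] /(_ _ (diffs1 tR'))]; by rewrite mulg1.
move=> c hc; apply: contrapT => nRc.
have tC := type_definable_mul hS hG c 1%g (type_definable_thick_interiorC R).
have : hull `<=` [set x | ~ thick_interior R (c * x * 1)%g].
  apply: (hull_min hS hG sA sN AN cN tC) => [x g|h Hh].
    rewrite /= !mulg1 mulgA => nx Gg; apply: contra_not nx => Rx.
    have := thick_interior_mulr (subgroupV hH (GH Gg)) Rx; by rewrite mulgK.
  rewrite /= mulg1; apply: contra_not nRc => Rc.
  by have := thick_interior_mulr (subgroupV hH Hh) Rc; rewrite mulgK.
have hT := hull_subgroup hS hG sA sN AN cN hH.
move=> /(_ _ (subgroupV hT hc)); rewrite /= mulgV mulg1; apply.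
exists R => // x Rx; rewrite mul1g; exists 1%g; first exact: subgroup1.
by exists x => //; rewrite mul1g.
Qed.

(** The hull is type-definable over [A], hence contains both factors. Conversely [hull_thick]
    factors each of its points through every [D] containing [H] and every [diffs R], and compactness
    chooses one first factor [y] for all of them. *)
Lemma hullE : hull = set_mul (tclosure S A H) (XTheta S A).
Proof.
have hT := hull_subgroup hS hG sA sN AN cN hH.
have tT := type_definable_base_hull hS hG sA sN AN cN hH GH iH.
apply/seteqP; split=> [t ht|_ [x cx [y Ty <-]]]; last first.
  apply: (subgroupM hT).
    exact: (tclosure_sub (@sub_hull _ _ _ _ _ _ _) tT).
  by apply: sub_hull; apply: (XTheta_subgroup sA).
pose P := [set i : set G * (G -> G -> Prop) |
  [/\ definable S A i.1, H `<=` i.1 & thick_rel S A i.2]].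
have [|[D R] [/= dD HD tR]|[D R] [D' R'] [/= dD HD tR] [/= dD' HD' tR']||
    [D R] [/= dD HD tR]|y hy] :=
  @compactness K L G S hG (A `|` [set t]) _ P
    (fun i => [set y | i.1 y /\ diffs i.2 (y^-1 * t)%g]).
- by apply: small_setU => //; apply: small_set1 hG _ _.
- have sub : A `<=` A `|` [set t] by move=> x; left.
  have [dR _ _] := tR; apply/definableE/dpred_and.
    by apply: (dpred_definable (definable_sub sub dD)); dvar.
  apply: (dpred_definable (definable_diffs (definable2_sub sub dR))).
  apply: dterm_mul => //; last by apply: dterm_par; right.
  by apply: dterm_inv => //; dvar.
- have [R'' tR'' sub] := thick_directed tR tR'; exists (D `&` D', R'').
    split=> //=; first exact: definableI.
    by move=> x Hx; split; [apply: HD|apply: HD'].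
  move=> y [[Dy D'y] /diffsE[a /sub[Ra R'a]]].
  by split; split=> //; apply/diffsE; exists a.
- exists (setT, fun _ _ => True); split=> //=; first exact: definableT.
  exact: thick_True.
- have [h Hh [z Rz E]] := hull_thick tR ht; exists h.
  by split; [apply: HD|rewrite -E /= mulKg].
exists y.
  move=> D [dD HD]; have [] := hy (D, fun _ _ => True) => //.
  by split=> //=; apply: thick_True.
exists (y^-1 * t)%g; last by rewrite mulVKg.
apply: XTheta_diffs => // R tR.
by have [] := hy (setT, R); first by split=> //=; apply: definableT.
Qed.

End NormalSubgroup.
End Neighbourhoods.

(** * Passage to the quotient and conclusion *)

Lemma quot_projE K (L : group_language) (G : groupType) (S : structure L G)
    (A N : set G) x y : is_subgroup (Ginf K S A) ->
  quot_proj K S A N x = quot_proj K S A N y <-> Ginf K S A (x^-1 * y)%g.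
Proof.
move=> hH; rewrite -(left_coset_eq _ _ hH); split=> [/(congr1 val)//|E].
exact: val_inj.
Qed.

(** Preimages of closed sets are exactly the [Ginf]-stable sets type-definable over [N], so both
    intersections run over the same sets. *)
Lemma quot_closureE K (L : group_language) (G : groupType) (S : structure L G)
    (A N H : set G) : is_subgroup (Ginf K S A) ->
  quot_proj K S A N @^-1` closure (quot_proj K S A N @` H) = hull K S A N H.
Proof.
move=> hG; rewrite closureE; apply/seteqP; split=> x hx.
- move=> X [tX stX HX]; have iX : quot_proj K S A N @^-1`
      (quot_proj K S A N @` X) = X.
    apply/seteqP; split=> [z [y Xy /quot_projE Gyz]|z Xz]; last by exists z.
    by rewrite -[z](mulVKg y); apply: stX => //; apply: Gyz.
  rewrite -iX; apply: hx; split; last exact: image_subset.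
  by apply/logic_closedE; rewrite iX.
- move=> Z [cZ HZ]; apply: (hx (quot_proj K S A N @^-1` Z)); split.
  + exact/logic_closedE.
  + move=> y g Zy Gg; rewrite /preimage /=.
    have <- // : quot_proj K S A N y = quot_proj K S A N (y * g)%g.
    by apply/quot_projE; rewrite // mulKg.
  + by move=> h Hh; apply: HZ; exists h.
Qed.

Unset Implicit Arguments.
Set Strict Implicit.
Set Printing Implicit Defensive.

Theorem theorem2p5 (K : Type) (L : group_language) (G : groupType)
    (S : structure L G) (hS : expands_group S) (hG : monster_model K S)
    (A : set G) (hA : small K A) :
  (forall H : set G,
     is_subgroup H -> aut_invariant S A H -> bounded_index K H ->
     forall N : set G,
       elementary_submodel S N -> small K N -> A `<=` N ->
       let i := quot_proj K S A N in
       let T := i @^-1` closure (i @` H) in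
       [/\ Ginf K S A `<=` H,
           [/\ is_subgroup T, type_definable K S T, H `<=` T
             & forall T' : set G,
                 is_subgroup T' -> type_definable K S T' -> H `<=` T' ->
                 T `<=` T'],
           forall M : set G,
             elementary_submodel S M -> small K M -> A `<=` M ->
             type_definable_over S M T
         & is_normal H ->
             T = set_mul (tclosure S A H) (XTheta S A) /\ is_normal T]) /\
  G00 K S A = set_mul (tclosure S A (Ginf K S A)) (XTheta S A).
Proof.
have [sG nG] := Ginf_normal hS hG hA.
split=> [H hH iH bH N eN sN AN i T|].
  have GH := Ginf_sub hH iH bH.
  have cN := elementary_submodel_covering eN AN.
  have -> : T = hull K S A N H by apply: quot_closureE.
  have tT := type_definable_hull S A H sN.
  split=> //.
  - split=> //; [exact: hull_subgroup|exact: sub_hull|exact: hull_least].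
  - move=> M eM sM AM; have cM := elementary_submodel_covering eM AM.
    apply: (type_definable_Ginf_stable hS hG hA sM AM cM _ tT).
    exact: hull_stable.
  - by move=> nH; split; [apply: hullE|apply: hull_normal].
(* No model is given for this part; a small covering set takes its place. *)
have [N [sN AN cN]] := small_covering hG hA.
have iG : aut_invariant S A (Ginf K S A) by apply: Ginf_invariant.
have bG := Ginf_bounded hS hG hA.
rewrite -(hullE hS hG hA (Ginf_normal hS hG hA) iG bG _ sN AN cN) //.
have hT := hull_subgroup hS hG hA sN AN cN sG.
apply/seteqP; split.
  (* The hull of [Ginf] is itself one of the subgroups intersected in [G00]. *)
  apply: bigcap_inf; split=> //.
    exact: (type_definable_base_hull hS hG hA sN AN cN sG).
  exact: (bounded_index_sub sG hT (@sub_hull _ _ _ _ _ _ _) bG).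
(* Conversely, each such subgroup is [A]-invariant, so it contains [Ginf] and hence the hull. *)
move=> x hx H [hH tH bH].
apply: (hull_least hS hG hA sN AN cN _ hH _ _ hx) => //; first by exists A.
by apply: Ginf_sub => //; apply: type_definable_aut_invariant.
Qed.
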